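(* Let $r$ be a positive integer with $r\le \frac N2$. Then the function $$\frac{f}{\prod_{i<j}^N(x_i^2-x_j^2)^{\frac1{2r}}}$$ is locally $L^2$-integrable on $\mathbb{R}^N$ for all $f\in K_{2r-1}$, where $K_{2r-1}\subset\mathbb{C}[x_1,\dots,x_N]$ is the ideal defined in the context.
   Context: A function $\Psi$ on $\mathbb{R}^N$ is locally $L^2$-integrable if every point has a neighbourhood $U$ with $\int_U|\Psi|^2dx<\infty$. Real powers are understood through absolute values (only $|\Psi|$ matters). Definition of the ideals. Let $\Delta(x_1,\dots,x_p)=\prod_{1\le i<j\le p}(x_i-x_j)$ for $p\ge2$ and $\Delta(x_1)=1$. For a partition $\nu=(\nu_1,\dots,\nu_l)$ of $N$ put $$p_\nu(x)=\Delta(x_1,\dots,x_{\nu_1})\,\Delta(x_{\nu_1+1},\dots,x_{\nu_1+\nu_2})\cdots\Delta(x_{\nu_1+\dots+\nu_{l-1}+1},\dots,x_N).$$ For $1\le k\le N-1$ write $N=kq+t$ with $q,t\in\mathbb{Z}_{\ge0}$, $t<k$, and let $\nu_N^k=((q+1)^t,q^{k-t})$ ($t$ parts equal to $q+1$ followed by $k-t$ parts equal to $q$). For $T\subset\{1,\dots,k\}$ and $\nu=\nu_N^k$ put $$p_{\nu,T}(x)=p_\nu(x_1^2,\dots,x_N^2)\prod_{j\in T}\prod_{i=1}^{\nu_j}x_{\nu_1+\dots+\nu_{j-1}+i}.$$ For $0\le s\le k$ let $T_{k,s}=\{k,k-1,\dots,k-s+1\}$ and let $K_{k,s}$ be the ideal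 of $\mathbb{C}[x_1,\dots,x_N]$ generated by all $\mathrm{S}_N$-images (permutations of variables) of $p_{\nu_N^k,T_{k,s}}$. For odd $k=2m+1$ put $K_k=K_{k,m}$; thus $K_{2r-1}=K_{2r-1,r-1}$. *)

(* Defs.v *)
From HB Require Import structures.
From mathcomp Require Import all_boot all_order all_algebra all_fingroup.
From mathcomp Require mpoly.

Set Implicit Arguments.
Unset Strict Implicit.
Unset Printing Implicit Defensive.

Import GRing.Theory.

Module Export Ideals.
Import mpoly.
Local Open Scope ring_scope.

Section blocks.
Variable A : comNzRingType.

Definition vdm (s : seq A) : A :=
  \prod_(i < size s) \prod_(j < size s | (i < j)%N) (s`_i - s`_j).

(* [reshape nu s] cuts s into consecutive blocks of lengths nu_1, ..., nu_l. *)
Definition p_part (nu : seq nat) (s : seq A) : A :=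
  \prod_(b <- reshape nu s) vdm b.

(* Blocks are numbered from 0: j \in T stands for the 1-based index j.+1. *)
Definition p_partT (nu : seq nat) (T : {pred nat}) (s : seq A) : A :=
  p_part nu [seq y ^+ 2 | y <- s] *
  \prod_(j < size nu | (j : nat) \in T)
     \prod_(y <- nth [::] (reshape nu s) j) y.

End blocks.

Definition nuNk (N k : nat) : seq nat :=
  (nseq (N %% k) (N %/ k).+1 ++ nseq (k - N %% k) (N %/ k))%N.

(* The 1-based set {k - s + 1, ..., k}, shifted to 0-based block numbers. *)
Definition Tks (k s : nat) : {pred nat} := [pred j | (k - s <= j < k)%N].

Section ideals.
Variables (C : comNzRingType) (N : nat).
Local Notation P := {mpoly C[N]}.

Definition ideal_gen (A : comNzRingType) (I : finType) (g : I -> A) (f : A) :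
    Prop :=
  exists c : I -> A, f = \sum_i c i * g i.

Definition vars : seq P := [seq 'X_i | i : 'I_N].

Definition Kks (k s : nat) : P -> Prop :=
  ideal_gen (fun w : 'S_N => msym w (p_partT (nuNk N k) (Tks k s) vars)).

(* Meant for odd k = 2 m + 1, for which k./2 = m. *)
Definition Kodd (k : nat) : P -> Prop := Kks k k./2.

Definition evalmp (f : P) (x : 'I_N -> C) : C := f.@[x].

End ideals.
End Ideals.

From mathcomp Require Import complex.
From mathcomp Require Import all_classical all_reals all_analysis.
Import Order.TTheory Num.Theory numFieldNormedType.Exports.
Local Open Scope classical_set_scope.
Local Open Scope ring_scope.

(* 'rV[T]_n carries the product sigma-algebra, as n.-tuple T does. *)
Section measurable_rV.
Context {d} {T : sigmaRingType d} (n : nat).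

Let coord : 'I_n -> 'rV[T]_n -> T := fun i v => v ord0 i.

Let rV_set0 : g_sigma_preimage coord set0.
Proof. exact: sigma_algebra0. Qed.

Let rV_setC A : g_sigma_preimage coord A -> g_sigma_preimage coord (~` A).
Proof. exact: sigma_algebraC. Qed.

Let rV_bigcup (F : (set 'rV[T]_n)^nat) :
  (forall i, g_sigma_preimage coord (F i)) ->
  g_sigma_preimage coord (\bigcup_i F i).
Proof. exact: sigma_algebra_bigcup. Qed.

HB.instance Definition _ := @isMeasurable.Build (measure_tuple_display d)
  'rV[T]_n (g_sigma_preimage coord) rV_set0 rV_setC rV_bigcup.

End measurable_rV.

Lemma measurable_coord d (T : sigmaRingType d) n (i : 'I_n) :
  measurable_fun [set: 'rV[T]_n] (fun v => v ord0 i).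
Proof.
move=> _ Y mY; rewrite setTI; apply: sub_sigma_algebra.
rewrite -bigcup_seq /=; exists i => /=; first by rewrite mem_index_enum.
by exists Y => //; rewrite setTI.
Qed.

Lemma measurable_fun_rV d d1 (T1 : measurableType d1) (T : sigmaRingType d) n
    (f : T1 -> 'rV[T]_n) :
  (forall i, measurable_fun [set: T1] (fun x => f x ord0 i)) ->
  measurable_fun [set: T1] f.
Proof.
move=> mf; apply: (@measurability _ _ _ _ _ _
  (\big[setU/set0]_(i < n) preimage_set_system [set: 'rV[T]_n]
     (fun v => v ord0 i) measurable)) => //.
move=> _ [B + <-]; rewrite -bigcup_seq /= => -[i _ [A mA <-]].
rewrite setTI setTI -comp_preimage; have := mf i measurableT _ mA.
by rewrite setTI.
Qed.


Section lebesgue_rV.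
Variable R : realType.
Local Open Scope ereal_scope.

Definition rV_cons n (p : R * 'rV[R]_n) : 'rV[R]_n.+1 :=
  row_mx (const_mx p.1 : 'rV_1) p.2.

Lemma rV_cons0 n (p : R * 'rV[R]_n) : rV_cons p ord0 ord0 = p.1.
Proof.
rewrite /rV_cons (_ : ord0 = lshift n (ord0 : 'I_1)); last exact: val_inj.
by rewrite (row_mxEl (const_mx p.1 : 'rV_1) p.2) mxE.
Qed.

Lemma rV_consS n (p : R * 'rV[R]_n) (i : 'I_n) :
  rV_cons p ord0 (lift ord0 i) = p.2 ord0 i.
Proof.
rewrite /rV_cons (_ : lift ord0 i = rshift 1 i); last exact: val_inj.
exact: (row_mxEr (const_mx p.1 : 'rV_1) p.2).
Qed.

Lemma measurable_rV_cons n :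
  measurable_fun [set: measurableTypeR R * 'rV[R]_n]
    (@rV_cons n : _ -> 'rV[R]_n.+1).
Proof.
apply: measurable_fun_rV => i; case: (unliftP ord0 i) => [j|] ->.
  rewrite (_ : (fun _ => _) = (fun v : 'rV[R]_n => v ord0 j) \o snd).
    exact: measurableT_comp (measurable_coord j) measurable_snd.
  by apply/funext => p; exact: rV_consS.
rewrite (_ : (fun _ => _) = fst); first exact: measurable_fst.
by apply/funext => p; exact: rV_cons0.
Qed.

Definition rV_uncons n (v : 'rV[R]_n.+1) : R * 'rV[R]_n :=
  (v ord0 ord0, \row_i v ord0 (lift ord0 i))%R.

Lemma rV_consK n : cancel (@rV_cons n) (@rV_uncons n).
Proof.
move=> [x v]; rewrite /rV_uncons rV_cons0; congr pair.
by apply/rowP => i; rewrite mxE rV_consS.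
Qed.

Lemma measurable_rV_uncons n :
  measurable_fun [set: 'rV[R]_n.+1]
    (@rV_uncons n : _ -> measurableTypeR R * 'rV[R]_n).
Proof.
apply: measurable_fun_pair; first exact: measurable_coord.
apply: measurable_fun_rV => i.
rewrite (_ : (fun _ => _) = fun v : 'rV[R]_n.+1 => v ord0 (lift ord0 i)).
  exact: measurable_coord.
by apply/funext => v; rewrite mxE.
Qed.

(* Iterated product of the one-dimensional Lebesgue measure. *)
Fixpoint lebesgue_rV n : set 'rV[R]_n -> \bar R :=
  match n with
  | 0 => dirac (0%R : 'rV[R]_0)
  | n'.+1 => pushforward (lebesgue_measure \x @lebesgue_rV n') (@rV_cons n')
  end.

Let measure_laws n :
  [/\ @lebesgue_rV n set0 = 0, forall A, 0 <= @lebesgue_rV n A,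
      semi_sigma_additive (@lebesgue_rV n) &
      sigma_finite setT (@lebesgue_rV n)].
Proof.
elim: n => [|n [m0 m_ge0 m_sadd m_sfin]].
  pose D : {measure set 'rV[R]_0 -> \bar R} := dirac (0%R : 'rV[R]_0).
  rewrite (_ : @lebesgue_rV 0 = D)//; split.
  - exact: measure0.
  - by move=> A; exact: measure_ge0.
  - exact: measure_semi_sigma_additive.
  - exists (fun=> setT); first by rewrite bigcup_const.
    by move=> i; split=> //; rewrite /D/= /dirac ltry.
pose M := isMeasure.Build _ _ _ (@lebesgue_rV n) m0 m_ge0 m_sadd.
pose T : measurableType _ := 'rV[R]_n.
pose mM : {measure set T -> \bar R} := HB.pack (@lebesgue_rV n : set _ -> \bar R) M.
pose S := Measure_isSigmaFinite.Build _ _ _ mM m_sfin.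
pose mu : {sigma_finite_measure set T -> \bar R} :=
  HB.pack (@lebesgue_rV n : set _ -> \bar R) S M.
pose P := [the {measure set _ -> \bar R} of lebesgue_measure \x mu].
have sfinP : sigma_finite setT P.
  have /sigma_finiteP[F [TF ndF Foo]] := sigma_finiteT (@lebesgue_measure R).
  have /sigma_finiteP[G [TG ndG Goo]] := sigma_finiteT mu.
  exists (fun k => F k `*` G k).
    rewrite -setXTT TF TG predeqE => -[x y]; split.
      move=> [/= [k _ Fkx] [l _ Gly]]; exists (maxn k l) => //; split.
      - by move: x Fkx; exact/subsetPset/ndF/leq_maxl.
      - by move: y Gly; exact/subsetPset/ndG/leq_maxr.
    by move=> [k _ []/= ? ?]; split; exists k.
  move=> k; have [? ?] := Foo k; have [? ?] := Goo k.
  split; first exact: measurableX.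
  rewrite [ltLHS](@product_measure1E _ _ _ _ _ lebesgue_measure mu)//.
  by rewrite lte_mul_pinfty// ge0_fin_numE.
have mcons A : measurable A -> measurable (@rV_cons n @^-1` A).
  by move=> mA; rewrite -[X in measurable X]setTI; exact: measurable_rV_cons.
rewrite (_ : @lebesgue_rV n.+1 = pushforward P (@rV_cons n))//; split.
- by rewrite /pushforward preimage_set0 measure0.
- by move=> A; exact: (measure_ge0 P).
- move=> F mF tF mUF; rewrite /pushforward preimage_bigcup.
  apply: (@measure_semi_sigma_additive _ _ _ P).
  + by move=> k; exact: mcons.
  + apply/trivIsetP => /= i j _ _ ij; rewrite -preimage_setI.
    by move/trivIsetP : tF => /(_ _ _ _ _ ij) ->//; rewrite preimage_set0.
  + by rewrite -preimage_bigcup; exact: mcons.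
- have [F TF Foo] := sfinP.
  exists (fun k => @rV_uncons n @^-1` F k).
    by rewrite -preimage_bigcup -TF preimage_setT.
  move=> k; have [mF Fk] := Foo k; split.
    by rewrite -[X in measurable X]setTI; exact: measurable_rV_uncons.
  rewrite /pushforward -comp_preimage.
  by rewrite (_ : _ \o _ = id)//; apply/funext => p; exact: rV_consK.
Qed.

HB.instance Definition _ n := isMeasure.Build _ _ _ (@lebesgue_rV n)
  (let: And4 h _ _ _ := measure_laws n in h)
  (let: And4 _ h _ _ := measure_laws n in h)
  (let: And4 _ _ h _ := measure_laws n in h).

HB.instance Definition _ n := Measure_isSigmaFinite.Build _ _ _
  (@lebesgue_rV n) (let: And4 _ _ _ h := measure_laws n in h).

Lemma lebesgue_rV_box n (A : 'I_n -> set R) :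
  (forall i, measurable (A i)) ->
  @lebesgue_rV n [set v | forall i, A i (v ord0 i)] =
  \prod_(i < n) lebesgue_measure (A i).
Proof.
elim: n A => [|n IHn] A mA.
  by rewrite big_ord0 /= diracE mem_set// => -[].
rewrite big_ord_recl -IHn; last by move=> i; exact: mA.
rewrite -(product_measure1E lebesgue_measure (@lebesgue_rV n))//=.
- rewrite /pushforward; congr ((_ \x _) _).
  apply/seteqP; split=> -[x v] /= => [Axv|[A0 AS] i].
    split; first by have := Axv ord0; rewrite rV_cons0.
    by move=> i; have := Axv (lift ord0 i); rewrite rV_consS.
  by case: (unliftP ord0 i) => [j|] ->; rewrite ?rV_cons0 ?rV_consS.
- exact: mA.
- rewrite (_ : (fun _ => _) = \bigcap_(i in [set: 'I_n])
      ((fun v : 'rV[R]_n => v ord0 i) @^-1` A (lift ord0 i))).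
    apply: fin_bigcap_measurable => // i _.
    by rewrite -[X in measurable X]setTI; exact: measurable_coord.
  by apply/seteqP; split=> v /= => [h i _|h i]; exact: h.
Qed.

End lebesgue_rV.

Section local_L2.
Variables (R : realType) (N : nat).
Local Open Scope complex_scope.

Definition locally_L2 (Psi : 'rV[R]_N -> R[i]) : Prop :=
  forall x : 'rV[R]_N, exists U : set 'rV[R]_N,
    [/\ nbhs x U, measurable U &
        (@lebesgue_rV R N).-integrable U
          (fun y => (ComplexField.Normc.normc (Psi y) ^+ 2)%:E)].

(* The denominator vanishes only on a null set, where the quotient is 0 by
   the convention z / 0 = 0. *)
Definition quot_vdm_sq (a : R) (f : mpoly.mpoly N R[i]) (x : 'rV[R]_N) : R[i] :=
  evalmp f (fun i => (x ord0 i)%:C) /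
  (\prod_(i < N) \prod_(j < N | (i < j)%N)
      `|x ord0 i ^+ 2 - x ord0 j ^+ 2| `^ a)%:C.

End local_L2.

(* Main.v *)
(* On a bounded box |f|^2 is dominated by squares of generators.  Put y_0 = 0
   and y_i = x_i^2.  Then |generator / denominator|^2 is the product of the
   |x_i|, which are the Jacobian of squaring, and of all
   |y_u - y_v|^weight(u, v).  If every set S of these n points has nonnegative
   degree, that is, total weight plus (1 - d)(|S| - 1), then cutting each S at
   a gap of length at least diam S / n bounds the second product by a constant
   times prod_(i > 0) sum_(j < i) |y_i - y_j|^(d - 1), by induction on |S|.
   This is integrated one coordinate at a time.  Nonnegativity of the degrees
   is a quadratic inequality in the sizes of the 2r - 1 blocks, which follows
   from tangent lines between consecutive integers. *)
Require Import Defs.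
From mathcomp Require Import all_boot all_order all_algebra all_fingroup.
From mathcomp Require Import ring lra zify.
From mathcomp Require mpoly.

Set Implicit Arguments.
Unset Strict Implicit.
Unset Printing Implicit Defensive.

Import Order.TTheory GRing.Theory Num.Theory.
Local Open Scope ring_scope.

(** * Generators as products over same-block pairs *)

(** The singular hyperplanes need not cross normally, so the exponents of single factors do not
    decide integrability; what counts is the power of diam S that is left when a cluster S
    collapses. A spanning tree of S has |S| - 1 edges, each granted the exponent d - 1, which is
    locally integrable in one variable exactly when d > 0. The value d = 1 / (2r(N + 1)) comes from
    integrality: at d = 0, 2r times a degree is an integer, at least 1 as soon as |S| > 1, and d
    takes only (|S| - 1) / (N + 1) < 1 away from it. The tree varies with the point, hence the sum
    over all candidate edges. Edges lead from an index to a smaller one, so the last coordinate is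
    the centre of no kernel. The substitution y = x^2 is never carried out: |x_i| is spent on the
    powers |x_i^2 - c^2|^(d - 1), which leaves kernels in x_i whose integrals are bounded uniformly
    in c. *)

Section BlockProducts.
Variable A : comNzRingType.
Implicit Types (s : seq A) (nu : seq nat) (T : {pred nat}).

Lemma reshape_index_cons n nu i :
  reshape_index (n :: nu) i =
  if (i < n)%N then 0%N else (reshape_index nu (i - n)).+1.
Proof.
rewrite /reshape_index /= subn_eq0; case: ltnP => // le_ni.
by rewrite -subSn.
Qed.

(** A single product over pairs of positions is the form on which permutations and logarithms act
    easily. Peeling off the first block loses nothing, since pairs across blocks contribute no
    factor. *)
Lemma p_partE nu s n : size s = n -> sumn nu = n ->
  Ideals.p_part nu s = \prod_(i < n) \prod_(j < n |
    (i < j)%N && (reshape_index nu i == reshape_index nu j)) (s`_i - s`_j).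
Proof.
elim: nu n s => [|m nu IH] n s /=.
  by move=> _ <-; rewrite /Ideals.p_part big_nil big_ord0.
move=> sz sz'; rewrite /Ideals.p_part /= big_cons.
have le_mn : (m <= n)%N by rewrite -sz' leq_addr.
have szd : size (drop m s) = sumn nu by rewrite size_drop sz -sz' addKn.
have szt : size (take m s) = m by rewrite size_takel ?sz.
rewrite -/(Ideals.p_part nu (drop m s)) (IH _ _ szd erefl) -{}sz' in le_mn *.
rewrite /vdm szt big_split_ord; congr (_ * _); apply: eq_bigr => i _ /=.
  rewrite big_mkcond [RHS]big_mkcond big_split_ord /= [X in _ = _ * X]big1.
    rewrite mulr1; apply: eq_bigr => j _ /=.
    by rewrite !reshape_index_cons !ltn_ord eqxx andbT !nth_take.
  by move=> j _; rewrite !reshape_index_cons ltn_ord [(m + j < m)%N]ltnNge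
    leq_addr andbF.
rewrite big_mkcond [RHS]big_mkcond big_split_ord /= [X in _ = X * _]big1.
  rewrite mul1r; apply: eq_bigr => j _ /=.
  by rewrite !reshape_index_cons ![(m + _ < m)%N]ltnNge !leq_addr /= !addKn
    eqSS ltn_add2l !nth_drop.
by move=> j _; rewrite ltnNge (leq_trans (ltnW (ltn_ord j)) (leq_addr _ _)).
Qed.

Lemma block_prodE nu T s n : size s = n -> sumn nu = n ->
  \prod_(j < size nu | (j : nat) \in T)
     \prod_(y <- nth [::] (reshape nu s) j) y =
  \prod_(i < n | reshape_index nu i \in T) s`_i.
Proof.
elim: nu n T s => [|m nu IH] n T s /=.
  by move=> _ <-; rewrite !big_ord0.
move=> sz sz'.
have le_mn : (m <= n)%N by rewrite -sz' leq_addr.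
have szd : size (drop m s) = sumn nu by rewrite size_drop sz -sz' addKn.
have szt : size (take m s) = m by rewrite size_takel ?sz.
rewrite big_mkcond big_ord_recl -big_mkcond /=.
rewrite (IH _ (fun i => i.+1 \in T) _ szd erefl) -{}sz' in le_mn *.
rewrite [RHS]big_mkcond big_split_ord -2!big_mkcond /=; congr (_ * _).
  transitivity (\prod_(i < m | 0%N \in T) s`_i).
    case: ifP => _; last by rewrite big_pred0.
    rewrite (big_nth 0) szt big_mkord.
    by apply: eq_bigr => i _; rewrite nth_take.
  by apply: eq_bigl => i; rewrite reshape_index_cons ltn_ord.
apply: eq_big => [i|i _]; last by rewrite nth_drop.
by rewrite reshape_index_cons ltnNge leq_addr /= addKn.
Qed.

Lemma p_partTE nu T n (x : 'I_n -> A) : sumn nu = n ->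
  p_partT nu T [seq x i | i : 'I_n] =
  \prod_(i < n) \prod_(j < n |
    (i < j)%N && (reshape_index nu i == reshape_index nu j))
      (x i ^+ 2 - x j ^+ 2) *
  \prod_(i < n | reshape_index nu i \in T) x i.
Proof.
move=> sz; have szx : size [seq x i | i : 'I_n] = n.
  by rewrite size_map size_enum_ord.
have nthx (f : A -> A) (i : 'I_n) : (map f [seq x i | i : 'I_n])`_i = f (x i).
  by rewrite -map_comp (nth_map i) ?size_enum_ord// nth_ord_enum.
rewrite /p_partT (p_partE (etrans (size_map _ _) szx) sz).
congr (_ * _).
  by apply: eq_bigr => i _; apply: eq_bigr => j _; rewrite !nthx.
rewrite [LHS](block_prodE T szx sz).
by apply: eq_bigr => i _; rewrite -(nthx id) map_id.
Qed.

End BlockProducts.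

Lemma rmorph_vdm (A B : comNzRingType) (phi : {rmorphism A -> B}) s :
  phi (vdm s) = vdm (map phi s).
Proof.
rewrite /vdm size_map rmorph_prod; apply: eq_bigr => i _.
rewrite rmorph_prod; apply: eq_bigr => j _.
by rewrite rmorphB !(nth_map 0).
Qed.

Lemma rmorph_p_partT (A B : comNzRingType) (phi : {rmorphism A -> B}) nu T s :
  phi (p_partT nu T s) = p_partT nu T (map phi s).
Proof.
rewrite /p_partT /Ideals.p_part rmorphM !rmorph_prod -!map_comp; congr (_ * _).
  have -> : map ((fun y => y ^+ 2) \o phi) s = map phi [seq y ^+ 2 | y <- s].
    by rewrite -map_comp; apply: eq_map => y /=; rewrite rmorphXn.
  by rewrite -(map_reshape phi) big_map; apply: eq_bigr => b _; exact:
    rmorph_vdm.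
apply: eq_bigr => j _; rewrite rmorph_prod -map_reshape.
by rewrite (nth_map [::]) ?size_reshape// big_map.
Qed.

Lemma sumn_nuNk N k : (0 < k)%N -> sumn (nuNk N k) = N.
Proof.
move=> k0; rewrite /nuNk sumn_cat !sumn_nseq [RHS](divn_eq N k).
have := ltn_pmod N k0; move: (N %/ k)%N (N %% k)%N => q t tk.
rewrite mulSn -addnA -mulnDr subnKC 1?ltnW//; exact: addnC.
Qed.

Lemma size_nuNk N k : (0 < k)%N -> size (nuNk N k) = k.
Proof.
by move=> k0; rewrite size_cat !size_nseq subnKC// ltnW// ltn_pmod.
Qed.

(** * Values of polynomials and of elements of the ideals *)

Module Export Evaluation.
Import mpoly.

Section Evaluation.
Variables (C : comNzRingType) (N : nat).

(** Later bounds and measurability proofs need only this finite sum of monomials, not the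
    representation of polynomials. *)
Lemma evalmpE (f : {mpoly C[N]}) : exists s : seq (C * ('I_N -> nat)),
  forall x, evalmp f x = \sum_(t <- s) t.1 * \prod_i x i ^+ t.2 i.
Proof.
exists [seq (f@_m, fun i => m i) | m <- msupp f] => x.
by rewrite big_map /evalmp mevalE.
Qed.

Lemma evalmp_msym (w : 'S_N) (p : {mpoly C[N]}) x :
  evalmp (msym w p) x = evalmp p (x \o w).
Proof.
rewrite /evalmp [in LHS](mpolyE p) [in RHS](mpolyE p) (raddf_sum (msym w))
  !(raddf_sum (meval _)) /=.
apply: eq_bigr => m _.
rewrite msymZ msymX !mevalZ !mevalX; congr (_ * _).
rewrite (reindex_inj (@perm_inj _ w)) /=.
by apply: eq_bigr => i _; rewrite mnmE permK.
Qed.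

Lemma evalmp_Kks k s (f : {mpoly C[N]}) : (0 < k)%N -> Kks k s f ->
  exists c : 'S_N -> {mpoly C[N]},
    forall x, evalmp f x = \sum_w evalmp (c w) x *
    (let bl i := reshape_index (nuNk N k) i in
     \prod_(i < N) \prod_(j < N | (i < j)%N && (bl i == bl j))
        (x (w i) ^+ 2 - x (w j) ^+ 2) *
     \prod_(i < N | bl i \in Tks k s) x (w i)).
Proof.
move=> k0 [c ->]; exists c => // x; rewrite /evalmp raddf_sum /=.
apply: eq_bigr => w _; rewrite mevalM; congr (_ * _).
rewrite -[LHS]/(evalmp _ _) evalmp_msym /evalmp rmorph_p_partT /vars -map_comp.
rewrite -(p_partTE _ _ (sumn_nuNk N k0)); congr p_partT.
by apply: eq_map => i /=; rewrite mevalXU.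
Qed.

End Evaluation.
End Evaluation.

(** * Logarithmic bound for weighted products of distances *)

Lemma ler_sum_in (R : numDomainType) (I : finType) (A : {set I}) (F : I -> R) :
  (forall i, 0 <= F i) -> \sum_(i in A) F i <= \sum_i F i.
Proof.
by move=> F0; rewrite [leRHS](bigID (mem A)) /= lerDl sumr_ge0.
Qed.

Lemma sum_disjointU (R : nmodType) (I : finType) (A B : {set I}) (F : I -> R) :
  [disjoint A & B] ->
  \sum_(i in A :|: B) F i = \sum_(i in A) F i + \sum_(i in B) F i.
Proof.
by move=> dAB; rewrite -bigU//; apply: eq_bigl => i; rewrite !inE.
Qed.

Section LogBound.
Variables (R : realFieldType) (n : nat) (ell eps : 'I_n -> 'I_n -> R).
Variables (h : 'I_n -> R) (e kappa : R).
Implicit Types (S A B : {set 'I_n}) (L : R).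

(** With [ell] the logarithm of the distance, [L] is the logarithm of the diameter of [S], and the
    distances between [A] and [B] agree with the diameter up to the factor exp [kappa]. *)
Definition is_split S A B L :=
  [/\ A :|: B = S, [disjoint A & B], A != set0 & B != set0] /\
  [/\ exists i j, [/\ i \in S, j \in S, i != j & L = ell i j],
      forall i j, i \in S -> j \in S -> i != j -> ell i j <= L &
      forall i j, i \in A -> j \in B -> L - kappa <= ell i j].

Lemma is_splitC S A B L : (forall i j, ell i j = ell j i) ->
  is_split S A B L -> is_split S B A L.
Proof.
move=> ellC [[ABS dAB A0 B0] [Lex Lmax Lmin]].
split; first by split; rewrite // 1?setUC// disjoint_sym.
by split=> // i j iB jA; rewrite ellC; exact: Lmin.
Qed.

Hypothesis ellC : forall i j, ell i j = ell j i.
Hypothesis epsii : forall i, eps i i = 0.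
Hypothesis kappa_ge0 : 0 <= kappa.
Hypothesis e_ge0 : 0 <= e.
Hypothesis split_ex : forall S, (1 < #|S|)%N -> exists A B L, is_split S A B L.
Hypothesis h_ge : forall i j : 'I_n, (j < i)%N -> - e * ell i j <= h i.

(* Exponent of the diameter of S once the edges of a spanning tree of S have
   been given the exponent - e. *)
Definition degree S := \sum_(i in S) \sum_(j in S) eps i j + e * (#|S|%:R - 1).
Let Q S := \sum_(i in S) \sum_(j in S) eps i j * ell i j.
Let E := \sum_i \sum_j `|eps i j|.

Hypothesis degree_ge0 : forall S, S != set0 -> 0 <= degree S.

Let sumsetU A B (F : 'I_n -> 'I_n -> R) : [disjoint A & B] ->
  \sum_(i in A :|: B) \sum_(j in A :|: B) F i j =
  \sum_(i in A) \sum_(j in A) F i j + \sum_(i in B) \sum_(j in B) F i j +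
  (\sum_(i in A) \sum_(j in B) F i j + \sum_(i in B) \sum_(j in A) F i j).
Proof.
move=> dAB; have FU i : \sum_(j in A :|: B) F i j =
    \sum_(j in A) F i j + \sum_(j in B) F i j by rewrite sum_disjointU.
by rewrite (eq_bigr _ (fun i _ => FU i)) sum_disjointU//= !big_split /=; ring.
Qed.

(** Replacing [ell i j] by [L] costs at most [kappa] times the absolute value of the exponent,
    whatever its sign. *)
Let cross A B L :
  (forall i j, i \in A -> j \in B -> L - kappa <= ell i j <= L) ->
  \sum_(i in A) \sum_(j in B) eps i j * ell i j <=
  (\sum_(i in A) \sum_(j in B) eps i j) * L + kappa * E.
Proof.
move=> H; rewrite mulr_suml.
under [X in _ <= X + _]eq_bigr do rewrite mulr_suml.
rewrite -lerBlDl -sumrB /E mulr_sumr.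
under eq_bigr do rewrite -sumrB.
have pos i j : 0 <= kappa * `|eps i j| by rewrite mulr_ge0.
apply: le_trans (_ : \sum_(i in A) kappa * \sum_j `|eps i j| <= _); last first.
  by apply: ler_sum_in => i; rewrite mulr_ge0// sumr_ge0.
apply: ler_sum => i iA; rewrite mulr_sumr.
apply: le_trans (_ : \sum_(j in B) kappa * `|eps i j| <= _); last first.
  exact: ler_sum_in.
apply: ler_sum => j jB; have /andP[] := H i j iA jB.
have := ler_norm (eps i j); have := lerNnormlW (lexx `|eps i j|).
rewrite -mulrBr; nra.
Qed.

(* After splitting S = A :|: B at scale L, the tree edge joining the two parts
   is (min B, min A): it pays e * L against h (min B). *)
Lemma log_bound S : S != set0 ->
  exists m, [/\ m \in S, forall i, i \in S -> (m <= i)%N &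
  forall lam, (forall i j, i \in S -> j \in S -> i != j -> ell i j <= lam) ->
  Q S <= (#|S|%:R - 1) * (2 * kappa * E) + degree S * lam
         + \sum_(i in S | i != m) h i].
Proof.

have [k] := ubnP #|S|; elim: k S => // k IH S Sk S0.
have [S1|] := leqP #|S| 1.
  have /cards1P[m Sm] : #|S| == 1%N by rewrite eqn_leq S1 card_gt0.
  exists m; rewrite {}Sm in S1 Sk S0 *; split.
  - by rewrite set11.
  - by move=> i; rewrite inE => /eqP ->.
  move=> lam _; rewrite /Q /degree cards1 !big_set1 !epsii subrr mulr0 !mul0r.
  by rewrite addr0 mul0r add0r big_pred0 ?addr0// => i; rewrite inE andbN.
move=> S1; have [A [B [L spl]]] := split_ex S1.
have [cA cB A0 B0] : [/\ (#|A| < k)%N, (#|B| < k)%N, A != set0 & B != set0].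
  case: spl => -[ABS dAB A0 B0] _; move: Sk (A0) (B0).
  by rewrite -ABS cardsU disjoint_setI0// cards0 -!card_gt0; split=> //; lia.
have [a [aA amin IHa]] := IH A cA A0; have [b [bB bmin IHb]] := IH B cB B0.
clear cA cB A0 B0.
(* By symmetry [a] is the minimum of [S]; then [b] is the only index of [S] whose [h] is not yet
   used by the two induction hypotheses. *)
wlog ab : A B spl a aA amin IHa b bB bmin IHb / (a < b)%N.
  move=> W; case: (ltngtP a b) => [ab|ba|/ord_inj ab].
  - exact: (W A B spl a _ _ _ b).
  - exact: (W B A (is_splitC ellC spl) b _ _ _ a).
  - by case: spl => -[_ dAB _ _] _; move: bB; rewrite -ab (disjointFr dAB aA).
case: spl => -[ABS dAB A0 B0] [[p [q [pS qS pq Lpq]]] Lmax Lmin].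
have AS i : i \in A -> i \in S by rewrite -ABS inE => ->.
have BS i : i \in B -> i \in S by rewrite -ABS inE orbC => ->.
have ABneq i j : i \in A -> j \in B -> i != j.
  by move=> iA; apply: contraTneq => <-; rewrite (disjointFr dAB iA).
exists a; split=> [||lam lamP]; first exact: AS.
  by move=> i; rewrite -ABS inE => /orP[/amin//|/bmin]; exact/leq_trans/ltnW.
have {}IHa := IHa L (fun i j iA jA => Lmax i j (AS i iA) (AS j jA)).
have {}IHb := IHb L (fun i j iA jA => Lmax i j (BS i iA) (BS j jA)).
have QS : Q S = Q A + Q B + (\sum_(i in A) \sum_(j in B) eps i j * ell i j +
    \sum_(i in B) \sum_(j in A) eps i j * ell i j).
  by rewrite /Q -ABS sumsetU.
have cAB := @cross A B L; have cBA := @cross B A L.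
have {}cAB := cAB (fun i j iA jB => introT andP
   (conj (Lmin i j iA jB) (Lmax i j (AS i iA) (BS j jB) (ABneq i j iA jB)))).
have {}cBA : \sum_(i in B) \sum_(j in A) eps i j * ell i j <=
  (\sum_(i in B) \sum_(j in A) eps i j) * L + kappa * E.
  apply: cBA => i j iB jA; rewrite ellC Lmin//=.
  by apply: Lmax; [exact: AS|exact: BS|exact: ABneq].
have hb := h_ge ab.
have eL : e * ell b a <= e * L.
  by rewrite ler_wpM2l// ellC; apply: Lmax; [exact: AS|exact: BS|exact: ABneq].
have cardS : #|S| = (#|A| + #|B|)%N by rewrite -ABS cardsU disjoint_setI0//
  cards0 subn0.
(* [L] is attained by a pair of [S], hence at most [lam]; a nonnegative degree preserves the
   inequality. *)
have LS : degree S * L <= degree S * lam.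
  by rewrite ler_wpM2l ?degree_ge0// Lpq lamP.
have hS : \sum_(i in S | i != a) h i = \sum_(i in A | i != a) h i +
    (h b + \sum_(i in B | i != b) h i).
  rewrite [LHS]big_mkcondr [X in _ = X + _]big_mkcondr -ABS sum_disjointU//=;
    congr (_ + _).
  rewrite (bigD1 b)//= -val_eqE gtn_eqF//; congr (_ + _).
  apply: eq_bigr => i /andP[iB _]; rewrite -val_eqE gtn_eqF//.
  exact: leq_trans ab (bmin _ iB).
have dS : degree S = degree A + degree B + e + (\sum_(i in A) \sum_(j in B) eps
  i j +
    \sum_(i in B) \sum_(j in A) eps i j).
  rewrite /degree -{1 2}ABS sumsetU// cardS natrD; lra.
rewrite QS hS cardS natrD; move: LS; rewrite dS.
move: cAB cBA.
lra.
Qed.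

End LogBound.

(** * Nonnegativity of the degrees *)

Section Counting.
Local Open Scope nat_scope.

(** Here k + 1 stands for 2r. The last hypothesis says that [Q] is at least k c^2 + 2 c i + i, the
    sum of squares of the balanced distribution with i parts c + 1 and k - i parts c. *)
Lemma sum_sqr_arith k c i Q : i < k -> 1 < c * k + i ->
  (2 * c + 1) * (c * k + i) <= Q + k * (c * c.+1) ->
  k + 1 + (c * k + i) * (c * k + i) + 1 <= (k + 1) * Q + (c * k + i).
Proof.
move=> ik p1 HQ.
have {}HQ : k * c * c + 2 * c * i + i <= Q by lia.
have {}HQ := leq_mul (leqnn (k + 1)) HQ.
(* For c = 0 the claim amounts to 1 <= (i - 1)(k + 1 - i), where i is at least 2. *)
have [c0|c0] := posnP c.
  have : 1 * 2 <= (i - 1) * (k + 1 - i) by apply: leq_mul; lia.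
  have := @mulnBl i 1 (k + 1 - i); rewrite mulnBr. subst c. 
  have : i * i <= i * (k+1) by rewrite leq_mul//; lia.
  lia.
have : k * c * 1 <= k * c * c by rewrite leq_mul.
have : k * 1 <= k * c by rewrite leq_mul.
have : i * i <= k * i by rewrite leq_mul// ltnW.
lia.
Qed.

(** With s = r - 1, the remainder i is low when its points all fit into the r blocks outside T, one
    in each. *)
Lemma sum_sqr_shift_arith_low s m i W : i <= s.+1 -> 0 < m * (s + s.+1) + i ->
  (2 * m + 1) * (m * (s + s.+1) + i) <= W + (s * (m * m) + s.+1 * (m * m.+1)) ->
  s.+1 * (m * (s + s.+1) + i) + (m * (s + s.+1) + i) * (m * (s + s.+1) + i) + 1
    <= 2 * s.+1 * W + (m * (s + s.+1) + i).
Proof.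
move=> ir p0 HW.
have {}HW : m * m * (s + s.+1) + m * s + 2 * m * i + i <= W by lia.
have {}HW := leq_mul (leqnn (2 * s.+1)) HW.
have [i0|i0] := posnP i.
  have m0 : 0 < m by rewrite i0 addn0 muln_gt0 in p0; case/andP: p0.
  have : 1 * (s + s.+1) <= m * m * (s + s.+1) by rewrite leq_mul// muln_gt0 m0.
  subst i; lia.
have : i * 1 <= i * (s.+1 + 1 - i) by rewrite leq_mul//; lia.
have := @mulnBr i (s.+1 + 1) i.
have : i * i <= i * (s.+1 + 1) by rewrite leq_mul//; lia.
lia.
Qed.

Lemma sum_sqr_shift_arith_high s m i W : s.+1 < i < s + s.+1 ->
  (2 * m + 2) * (m * (s + s.+1) + i) <= W + (s * (m * m.+1) + s.+1 * (m.+1 *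
    m.+1)) ->
  s.+1 * (m * (s + s.+1) + i) + (m * (s + s.+1) + i) * (m * (s + s.+1) + i) + 1
    <= 2 * s.+1 * W + (m * (s + s.+1) + i).
Proof.
move=> /andP[ri ik] HW.
(* In the extremal distribution, j blocks of T receive one of the remaining points. *)
have [j ij] : exists j, i = s.+1 + j by exists (i - s.+1); lia.
have {}HW : m.+1 * (m * (s + s.+1) + s.+1 + 2 * j) <= W by lia.
have {}HW := leq_mul (leqnn (2 * s.+1)) HW.
have : j * j <= j * s.+1 by rewrite leq_mul//; lia.
lia.
Qed.

Variable r : nat.
Hypothesis r0 : 0 < r.
Let k := (2 * r - 1).
Variable a : 'I_k -> nat.
Let p := \sum_j a j.

(** This is (x - c)(x - c - 1) >= 0, as no integer lies strictly between c and c + 1. *)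
Let tangent (x c : nat) : (2 * c + 1) * x <= x * x + c * c.+1.
Proof. by case: (leqP x c) => xc; nia. Qed.

Let sum_ge (F : 'I_k -> nat) (c : nat) (d : 'I_k -> nat) :
  (forall j, c * a j <= F j + d j) -> c * p <= \sum_j F j + \sum_j d j.
Proof.
by move=> H; rewrite -big_split big_distrr; apply: leq_sum => j _; exact: H.
Qed.

Let k0 : 0 < k. Proof. by rewrite /k; lia. Qed.
Let pE : p = p %/ k * k + p %% k. Proof. exact: divn_eq. Qed.
Let ik : p %% k < k. Proof. exact: ltn_pmod. Qed.

(** For p points other than 0, this says that 2r times the degree at d = 0 is at least 1. A single
    point has degree 0 and must be excluded. *)
Lemma sum_sqr_ge : 1 < p ->
  2 * r + p * p + 1 <= 2 * r * (\sum_j a j * a j) + p.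
Proof.
have -> : 2 * r = k + 1 by rewrite /k; lia.
have := @sum_ge (fun j => a j * a j) _ _ (fun j => tangent (a j) (p %/ k)).
rewrite sum_nat_const card_ord.
move: ik pE; move: (p %/ k) (p %% k) (\sum_j _) => c i Q lt_ik -> le_pQ p_gt1.
exact: sum_sqr_arith.
Qed.

(** The same bound for the point 0 together with p others; the second sum counts the points of the r
    - 1 blocks of T. *)
Lemma sum_sqr_shift_ge : 0 < p ->
  r * p + p * p + 1 <=
  2 * r * (\sum_j a j * a j + \sum_(j < k | r <= j) a j) + p.
Proof.
have kE : r.-1 + r = k by rewrite /k; lia.
have cst x y : \sum_(j < k) (if r <= j then x else y) = r.-1 * x + r * y.
  rewrite -kE addnC big_split_ord /= addnC; congr addn.
    under eq_bigr => j _ do rewrite leq_addr.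
    by rewrite sum_nat_const card_ord.
  under eq_bigr => j _ do rewrite leqNgt ltn_ord.
  by rewrite sum_nat_const card_ord.
rewrite [X in 2 * r * (_ + X)]big_mkcond -big_split /=.
(* A new point in a block of size a costs 2a + 1 outside T and 2a + 2 inside. After m points in
   every block, the next r go outside T at cost 2m + 1, the others inside at cost 2m + 2; the slope
   of the tangent lines is the cost reached. *)
have [le_ir|lt_ri] := leqP (p %% k) r.
  have := @sum_ge (fun j : 'I_k => a j * a j + (if r <= j then a j else 0))
    (2 * (p %/ k) + 1)
    (fun j : 'I_k => if r <= j then (p %/ k) * (p %/ k) else (p %/ k) * (p %/
      k).+1).
  rewrite cst; move: pE le_ir.
  move: (p %/ k) (p %% k) (\sum_(j < k) _) => m i W -> le_ir le_pW.
  move=> p_gt0; have := @sum_sqr_shift_arith_low r.-1 m i W; rewrite prednK//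
    kE.
  apply=> //; apply: le_pW => j; case: ifP => _.
    by case: (leqP (a j) m) => ?; nia.
  by rewrite addn0 tangent.
have := @sum_ge (fun j : 'I_k => a j * a j + (if r <= j then a j else 0))
  (2 * (p %/ k) + 2)
  (fun j : 'I_k => if r <= j then (p %/ k) * (p %/ k).+1
                   else (p %/ k).+1 * (p %/ k).+1).
rewrite cst; move: pE ik lt_ri.
move: (p %/ k) (p %% k) (\sum_(j < k) _) => m i W -> lt_ik lt_ri le_pW.
move=> p_gt0; have := @sum_sqr_shift_arith_high r.-1 m i W; rewrite prednK// kE.
apply; first by rewrite lt_ri.
apply: le_pW => j; case: ifP => _.
  by have := tangent (a j) m; lia.
by case: (leqP (a j) m) => ?; nia.
Qed.

End Counting.

(** * Degrees in terms of block counts *)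

Section Degree.
Variables (R : realFieldType) (N r : nat) (bl : 'I_N -> 'I_(2 * r - 1)).
Hypothesis r0 : (0 < r)%N.

(* Index ord0 is the extra point 0.  Each unordered pair is shared equally
   between (u, v) and (v, u); the - 2^-1 is the Jacobian exponent. *)
Definition weight (u v : 'I_N.+1) : R :=
  match unlift ord0 u, unlift ord0 v with
  | Some i, Some j => if i == j then 0 else (bl i == bl j)%:R - (2 * r)%:R^-1
  | None, Some j | Some j, None => 2^-1 * ((r <= bl j)%N%:R - 2^-1)
  | None, None => 0
  end.

Lemma weight_diag u : weight u u = 0.
Proof. by rewrite /weight; case: unliftP => // i _; rewrite eqxx. Qed.

Let cnt (S : {set 'I_N}) b := #|[set i in S | bl i == b]|.

Let sum_cnt (S : {set 'I_N}) : (\sum_b cnt S b)%N = #|S|.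
Proof.
rewrite -sum1_card (partition_big bl predT)//=.
by apply: eq_bigr => b _; rewrite /cnt -sum1_card; apply: eq_bigl => i; rewrite
  inE.
Qed.

Let sum_same (S : {set 'I_N}) : \sum_(i in S) \sum_(j in S) (bl i == bl j)%:R =
  (\sum_b cnt S b * cnt S b)%:R :> R.
Proof.
rewrite natr_sum (partition_big bl predT)//=; apply: eq_bigr => b _.
transitivity (\sum_(i in S | bl i == b) (cnt S b)%:R : R).
  apply: eq_bigr => i /andP[_ /eqP ->].
  rewrite /cnt -sum1_card natr_sum [RHS]big_mkcond [LHS]big_mkcond.
  by apply: eq_bigr => j _; rewrite inE eq_sym; case: (j \in S); case: eqP.
rewrite sumr_const natrM [RHS]mulr_natl; congr (_ *+ _).
by apply: eq_card => i; rewrite !inE.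
Qed.

Let sum_shift (S : {set 'I_N}) : \sum_(i in S) (r <= bl i)%N%:R =
  (\sum_(b < 2 * r - 1 | (r <= b)%N) cnt S b)%:R :> R.
Proof.
rewrite natr_sum (partition_big bl predT)//= [RHS]big_mkcond.
apply: eq_bigr => b _.
transitivity (\sum_(i in S | bl i == b) (r <= b)%N%:R : R).
  by apply: eq_bigr => i /andP[_ /eqP ->].
rewrite sumr_const /cnt; case: ifP => _; last by rewrite mul0rn.
by congr (_ *+ _); apply: eq_card => i; rewrite !inE.
Qed.

Let big_set_ord_recl (S : {set 'I_N.+1}) (F : 'I_N.+1 -> R) :
  \sum_(u in S) F u = (if ord0 \in S then F ord0 else 0) +
    \sum_(i in [set i | lift ord0 i \in S]) F (lift ord0 i).
Proof.
rewrite big_mkcond big_ord_recl /= -big_mkcond; congr (_ + _).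
by apply: eq_bigl => i; rewrite inE.
Qed.

Lemma weight_degree_ge0 (S : {set 'I_N.+1}) : S != set0 ->
  0 <= degree weight (1 - (2 * r * N.+1)%:R^-1) S.
Proof.
move=> S0; rewrite /degree.
pose S' := [set i | lift ord0 i \in S]; pose p := #|S'|.
have SE : #|S|%:R = (ord0 \in S)%:R + p%:R :> R.
  have := big_set_ord_recl S (fun=> 1); rewrite !sumr_const => ->.
  by case: (ord0 \in S).
have w0 : weight ord0 ord0 = 0 by rewrite weight_diag.
pose w i : R := 2^-1 * ((r <= bl i)%N%:R - 2^-1).
have w0l i : weight ord0 (lift ord0 i) = w i.
  by rewrite /weight unlift_none liftK.
have wl0 i : weight (lift ord0 i) ord0 = w i.
  by rewrite /weight unlift_none liftK.
have wll i j : weight (lift ord0 i) (lift ord0 j) =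
    (bl i == bl j)%:R - (2 * r)%:R^-1 - (i == j)%:R * (1 - (2 * r)%:R^-1).
  rewrite /weight !liftK; case: eqVneq => [->|_]; first by rewrite eqxx mul1r
    subrr.
  by rewrite mul0r subr0.
pose V := \sum_(i in S') w i.
have VE : V = 2^-1 * (\sum_(b < 2 * r - 1 | (r <= b)%N) cnt S' b)%:R - p%:R / 4.
  rewrite /V -mulr_sumr sumrB sum_shift sumr_const -/p -[_ *+ p]mulr_natl.
  by move: (\sum_(b < _ | _) _)%N p%:R => T q; field.
pose D := \sum_(i in S') \sum_(j in S') weight (lift ord0 i) (lift ord0 j).
have DE : D = (\sum_b cnt S' b * cnt S' b)%:R - p%:R - (p%:R ^+ 2 - p%:R) / (2 *
  r)%:R.
  rewrite -sum_same; transitivity (\sum_(i in S')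
      (\sum_(j in S') (bl i == bl j)%:R - p%:R / (2 * r)%:R - (1 - (2 * r)%:R^-1
        : R))).
    apply: eq_bigr => i iS; under eq_bigr do rewrite wll.
    rewrite !sumrB -mulr_suml sumr_const -/p mulr_natl.
    congr (_ - _); rewrite (bigD1 i)//= eqxx big1 ?addr0 ?mul1r//.
    by move=> j /andP[_ ji]; rewrite eq_sym (negbTE ji).
  by rewrite !sumrB !sumr_const -/p -[_ / _ *+ p]mulr_natl -[_^-1 *+
    p]mulr_natl;
    move: (\sum_(i in S') _) p%:R (2 * r)%:R^-1 => Q q y; ring.
have -> : \sum_(u in S) \sum_(v in S) weight u v =
    (ord0 \in S)%:R * (2 * V) + D.
  have inner u := big_set_ord_recl S (weight u).
  rewrite big_set_ord_recl (eq_bigr _ (fun i _ => inner (lift ord0 i))).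
  rewrite inner big_split /= -/D w0.
  rewrite (eq_bigr _ (fun i _ => w0l i)) -/V.
  case: ifP => _; last by rewrite big1 ?add0r ?mul0r ?add0r.
  by rewrite if_same add0r (eq_bigr _ (fun i _ => wl0 i)) -/V mul1r mulr2n
    mulrDl mul1r addrA.
rewrite SE VE DE.
have sumS' : (\sum_b cnt S' b)%N = p := sum_cnt S'.
pose Q := (\sum_b cnt S' b * cnt S' b)%N; rewrite -/Q.
pose T := (\sum_(b < 2 * r - 1 | (r <= b)%N) cnt S' b)%N; rewrite -/T.
have pN : (p <= N)%N by rewrite -[X in (_ <= X)%N]card_ord max_card.
set x : R := (2 * r)%:R; set z : R := N.+1%:R^-1.
have x0 : 0 < x by rewrite ltr0n muln_gt0.
have z0 : 0 < z by rewrite invr_gt0 ltr0n.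
have pz : p%:R * z <= 1 by rewrite ler_pdivrMr ?ltr0n// mul1r ler_nat leqW.
have xE : x = 2 * r%:R by rewrite /x natrM.
have -> : (2 * r * N.+1)%:R^-1 = x^-1 * z by rewrite natrM invfM.
rewrite -(pmulr_rge0 _ x0).
have [S_0|S_0] := boolP (ord0 \in S).
  have -> : x * (1 * (2 * (2^-1 * T%:R - p%:R / 4)) +
      (Q%:R - p%:R - (p%:R ^+ 2 - p%:R) / x) + (1 - x^-1 * z) * (1 + p%:R - 1))
        =
      x * (Q%:R + T%:R) - r%:R * p%:R - p%:R * p%:R + p%:R - p%:R * z.
    by rewrite xE; move: Q%:R T%:R p%:R => Q' T' q; field; rewrite pnatr_eq0
      -lt0n.
  have [p0|p0] := posnP p.
    by rewrite p0 !mul0r mulr0 !subr0 addr0 mulr_ge0 ?(ltW x0)// addr_ge0.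
  have := @sum_sqr_shift_ge r r0 (cnt S'); rewrite sumS' -/Q -/T => /(_ p0).
  rewrite -(ler_nat R) !natrD !natrM natrD -natrM -/x; move: Q%:R T%:R p%:R pz
    => Q' T' q; lra.
have -> : x * (0 * (2 * (2^-1 * T%:R - p%:R / 4)) +
    (Q%:R - p%:R - (p%:R ^+ 2 - p%:R) / x) + (1 - x^-1 * z) * (0 + p%:R - 1)) =
    x * Q%:R - x - p%:R * p%:R + p%:R - (p%:R - 1) * z.
  by move: Q%:R p%:R => Q' q; field; rewrite pnatr_eq0 -lt0n.
have p0 : (0 < p)%N.
  rewrite lt0n; apply: contra_neq S0 => p0; apply/eqP; rewrite -cards_eq0.
  by rewrite -(eqr_nat R) SE p0 (negbTE S_0) addr0.
(* A single point: the strict counting bound fails, but the term with [z] vanishes too. *)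
have [p1|p1] := leqP p 1.
  have p_1 : p = 1%N by apply/eqP; rewrite eqn_leq p1.
  have Q1 : (1 <= Q)%N.
    rewrite -{1}p_1 -sumS'; apply: leq_sum => b _.
    by case: (cnt S' b) => // m; rewrite leq_pmull.
  have : x * 1 <= x * Q%:R by rewrite ler_wpM2l ?ler1n// ltW.
  by rewrite p_1; lra.
have := @sum_sqr_ge r r0 (cnt S'); rewrite sumS' -/Q => /(_ p1).
rewrite -(ler_nat R) !natrD [(2 * r * Q)%:R]natrM [(p * p)%:R]natrM -/x; move:
  Q%:R p%:R pz => Q' q; lra.
Qed.

End Degree.

From mathcomp Require Import complex.
From mathcomp Require Import all_classical all_reals all_analysis.
From mathcomp Require Import measurable_realfun.

Import numFieldNormedType.Exports.

(** * Pointwise domination of the quotient *)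

(* The n points leave empty one of the n half-open intervals of equal length
   that follow the leftmost point, since that point lies in none of them. *)
Lemma split_points (R : realType) n (y : 'I_n -> R) (S : {set 'I_n}) :
  injective y -> (1 < #|S|)%N ->
  exists A B L, is_split (fun i j => ln `|y i - y j|) (ln n%:R) S A B L.
Proof.
move=> yinj S1; have [s sS] : exists s, s \in S.
  by apply/finset.set0Pn; rewrite -card_gt0 ltnW.
have n0 : (0 < n)%N by case: n y S yinj S1 s sS => // ? ? ? ? [].
pose p := [arg min_(i < s in S) y i]%O; pose q := [arg max_(i > s in S) y i]%O.
have [pS pmin] : p \in S /\ forall i, i \in S -> y p <= y i.
  by rewrite /p; case: arg_minP.
have [qS qmax] : q \in S /\ forall i, i \in S -> y i <= y q.
  by rewrite /q; case: arg_maxP.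
have pq : p != q.
  apply/eqP => pq; move: S1; rewrite ltnNge => /negP; apply.
  rewrite -(cards1 p); apply/subset_leq_card/fintype.subsetP => i iS.
  rewrite inE; apply/eqP/yinj/le_anti.
  by rewrite pmin// andbT pq qmax.
pose L := y q - y p.
have L0 : 0 < L.
  by rewrite subr_gt0 lt_neqAle pmin// andbT; apply: contra_neq pq => /yinj.
pose w := L / n%:R; have w0 : 0 < w by rewrite divr_gt0// ltr0n.
have dS i j : i \in S -> j \in S -> `|y i - y j| <= L.
  move=> iS jS; have := pmin i iS; have := pmin j jS; have := qmax i iS.
  have := qmax j jS; rewrite /L ler_norml; lra.
have [j gap] : exists j : 'I_n, forall i, i \in S ->
    ~~ (y p + j%:R * w < y i <= y p + j.+1%:R * w).
  apply: contrapT => /forallNP H.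
  have {}H (j : 'I_n) : exists i, i \in S /\ y p + j%:R * w < y i <= y p +
    j.+1%:R * w.
    have /existsNP[i /not_implyP[iS /negP]] := H j.
    by rewrite negbK; exists i.
  have [f fP] := choice H.
  have finj : injective f.
    have flt (i j : 'I_n) : (i < j)%N -> y (f i) < y (f j).
      move=> ij; have [_ /andP[_ fi]] := fP i; have [_ /andP[fj _]] := fP j.
      apply: le_lt_trans fi (le_lt_trans _ fj).
      by rewrite lerD2l ler_wpM2r ?(ltW w0)// ler_nat.
    move=> i j fij; apply: val_inj; case: (ltngtP i j) => // /flt;
      by rewrite fij ltxx.
  have /codomP[j pj] := injF_onto finj p.
  have [_ /andP[+ _]] := fP j; rewrite -pj ltNge => /negP; apply.
  by rewrite lerDl mulr_ge0// ltW.
(* Cutting at the left end of the empty interval puts [B] beyond its right end, so cross distances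
   exceed [w], whose logarithm is ln L - ln n. *)
pose t := y p + j%:R * w.
pose A := [set i in S | y i <= t]%SET; pose B := [set i in S | t < y i]%SET.
have pA : p \in A by rewrite inE pS /= lerDl mulr_ge0// ltW.
have qB : q \in B.
  have LE : L = n%:R * w by rewrite mulrC divfK// pnatr_eq0 -lt0n.
  by rewrite inE qS /= /t -(subrK (y p) (y q)) -/L [ltLHS]addrC ltrD2r LE
    ltr_pM2r// ltr_nat.
exists A, B, (ln L); split.
  split.
  - by apply/finset.setP => i; rewrite !inE; case: leP; rewrite ?andbT ?andbF
    ?orbF.
  - rewrite -setI_eq0; apply/eqP/finset.setP => i; rewrite !inE.
    by case: leP; rewrite ?andbT ?andbF.
  - by apply/finset.set0Pn; exists p.
  - by apply/finset.set0Pn; exists q.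
split.
- by exists q, p; rewrite qS pS eq_sym pq gtr0_norm.
- move=> i k iS kS ik; rewrite ler_ln ?posrE ?dS// normr_gt0 subr_eq0.
  by apply: contra_neq ik => /yinj.
- move=> i k; rewrite !inE => /andP[iS it] /andP[kS kt].
  rewrite -ln_div ?posrE ?ltr0n// -/w.
  have := gap k kS; rewrite kt /= -ltNge -natr1 mulrDl mul1r addrA -/t => gk.
  by rewrite distrC ger0_norm ?ler_ln ?posrE; lra.
Qed.

(** The tree found by [log_bound] depends on [y]. Summing over all j < i dominates whichever edge it
    uses at i, so one function of [y] serves everywhere. *)
Lemma prod_powR_bound (R : realType) n (eps : 'I_n.+1 -> 'I_n.+1 -> R) (d M : R)
  :
  0 < M -> d <= 1 -> (forall i, eps i i = 0) ->
  (forall S : {set 'I_n.+1}, S != finset.set0 -> 0 <= degree eps (1 - d) S) ->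
  exists2 C : R, 0 < C & forall y : 'I_n.+1 -> R, injective y ->
    (forall i j, `|y i - y j| <= M) ->
    expR (\sum_i \sum_j eps i j * ln `|y i - y j|) <=
    C * \prod_(i < n) \sum_(j < n.+1 | (j < lift ord0 i)%N)
          `|y (lift ord0 i) - y j| `^ (d - 1).
Proof.
move=> M0 d1 epsii deg.
pose E := 2 * ln n.+1%:R * (\sum_i \sum_j `|eps i j|).
exists (expR (n%:R * E + degree eps (1 - d) [set: 'I_n.+1]%SET * ln M)).
  exact: expR_gt0.
move=> y yinj yM.
pose H (i : 'I_n.+1) := \sum_(j < n.+1 | (j < i)%N) `|y i - y j| `^ (d - 1).
have dist_gt0 i j : i != j -> 0 < `|y i - y j|.
  by move=> ij; rewrite normr_gt0 subr_eq0; apply: contra_neq ij => /yinj.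
have H_ge (i j : 'I_n.+1) : (j < i)%N -> `|y i - y j| `^ (d - 1) <= H i.
  by move=> ji; rewrite /H (bigD1 j)//= lerDl sumr_ge0// => ? _; exact:
    powR_ge0.
have h_ge (i j : 'I_n.+1) : (j < i)%N ->
    - (1 - d) * ln `|y i - y j| <= ln (H i).
  move=> ji; rewrite opprB -ln_powR ler_ln ?posrE ?H_ge//.
    by rewrite powR_gt0// dist_gt0// -val_eqE gtn_eqF.
  apply: lt_le_trans (H_ge _ _ ji).
  by rewrite powR_gt0// dist_gt0// -val_eqE gtn_eqF.
have T0 : [set: 'I_n.+1]%SET != finset.set0.
  by apply/finset.set0Pn; exists ord0; rewrite inE.
have [] := @log_bound R n.+1 (fun i j => ln `|y i - y j|) eps (fun i => ln (H
  i))
  (1 - d) (ln n.+1%:R) _ epsii _ _ _ h_ge deg _ T0.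
- by move=> i j; rewrite distrC.
- by rewrite ln_ge0// ler1n.
- by rewrite subr_ge0.
- by move=> S; exact: split_points.
move=> m [_ mmin /(_ (ln M))].
(* The root of the tree is the extra point, so exactly one factor remains for each of the n
   integration variables. *)
have -> : m = ord0 by apply/ord_inj/eqP; rewrite -leqn0; apply: (mmin ord0);
  rewrite inE.
move=> bnd; have {}bnd : \sum_i \sum_j eps i j * ln `|y i - y j| <=
    n%:R * E + degree eps (1 - d) [set: 'I_n.+1]%SET * ln M +
    \sum_(i < n) ln (H (lift ord0 i)).
  have sumT (F : 'I_n.+1 -> R) : \sum_(i in [set: 'I_n.+1]%SET) F i = \sum_i F
    i.
    by apply: eq_bigl => i; rewrite inE.
  have -> : \sum_(i < n) ln (H (lift ord0 i)) =
      \sum_(i in [set: 'I_n.+1]%SET | i != ord0) ln (H i).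
    rewrite [RHS]big_mkcond big_ord_recl eqxx andbF /= add0r.
    by apply: eq_bigr => i _; rewrite inE.
  have {}bnd := bnd (fun i j _ _ ij =>
    etrans (ler_ln (dist_gt0 i j ij) M0) (yM i j)).
  move: bnd; rewrite sumT (eq_bigr _ (fun i _ => sumT _)).
  by rewrite cardsT card_ord -[n.+1%:R]natr1 addrK natr1.
rewrite -ler_expR in bnd; apply: le_trans bnd _.
rewrite expRD expR_sum ler_wpM2l ?expR_ge0//.
apply: ler_prod => i _; rewrite expR_ge0 /=.
have i0 : (@ord0 n < lift ord0 i)%N by [].
rewrite lnK // posrE; apply: lt_le_trans (H_ge _ _ i0).
by rewrite powR_gt0// dist_gt0.
Qed.

Lemma sum_ltn_sym (R : comPzRingType) n (F : 'I_n -> 'I_n -> R) :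
  (forall i j, F i j = F j i) -> (forall i, F i i = 0) ->
  2 * (\sum_(i < n) \sum_(j < n | (i < j)%N) F i j) = \sum_i \sum_j F i j.
Proof.
move=> FC Fii; rewrite mulr2n mulrDl mul1r.
rewrite {2}(exchange_big_dep predT)//= -big_split /=; apply: eq_bigr => i _.
rewrite [RHS](bigID (fun j : 'I_n => (i < j)%N)) /=; congr (_ + _).
rewrite [RHS](bigD1 i) ?ltnn//= Fii add0r; apply: eq_big => // j.
by rewrite -leqNgt -val_eqE ltn_neqAle andbC.
Qed.

Definition squares (R : pzRingType) N (x : 'I_N -> R) (u : 'I_N.+1) : R :=
  if unlift ord0 u is Some i then x i ^+ 2 else 0.

(** * The kernel pulled back along squaring *)

Section Kernel.
Variables (R : realType) (d : R).

(** A pole at c^2 in the squared variable has the two preimages c and - c. *)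
Definition sing_kernel (x c : R) : R := `|x - c| `^ (d - 1) + `|x + c| `^ (d -
  1).

Lemma kernel_ge0 x c : 0 <= sing_kernel x c.
Proof. by rewrite addr_ge0// powR_ge0. Qed.

Lemma kernelN x c : sing_kernel x (- c) = sing_kernel x c.
Proof. by rewrite /sing_kernel opprK addrC. Qed.

(* The larger of |x - c| and |x + c| is at least |x|. *)
Lemma kernel_bound (M x c : R) : 0 < d -> d <= 1 -> `|x| <= M -> x != 0 ->
  x ^+ 2 != c ^+ 2 ->
  `|x| * `|x ^+ 2 - c ^+ 2| `^ (d - 1) <= M `^ d * sing_kernel x c.
Proof.
move=> d0 d1 xM x0; wlog xc : c / `|x| <= `|x + c| => [W|].
  have [/W//|xc] := leP `|x| `|x + c|.
  move=> xc2; rewrite -kernelN -(sqrrN c); apply: W; last by rewrite sqrrN.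
  have := ler_normD (x - c) (x + c).
  by rewrite addrACA addNr addr0 -mulr2n normrMn mulr2n; lra.
rewrite -subr_eq0 subr_sqr mulf_eq0 negb_or normrM => /andP[xmc xpc].
rewrite powRM// mulrCA mulrDr -[leLHS]addr0 lerD ?mulr_ge0 ?powR_ge0//.
rewrite mulrC ler_wpM2r ?powR_ge0//.
(* As d - 1 <= 0, the power of the larger factor is at most |x|^(d - 1), and the Jacobian |x| turns
   this into |x|^d. *)
apply: le_trans (_ : `|x| `^ d <= _).
  rewrite -[leRHS]mulr_powRB1 ?ler_wpM2l// -opprB !powRN lef_pV2 ?posrE.
  - by rewrite ge0_ler_powR ?nnegrE ?subr_ge0.
  - by rewrite powR_gt0 ?normr_gt0.
  - by rewrite powR_gt0 ?normr_gt0.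
by rewrite ge0_ler_powR ?nnegrE ?(ltW d0)// (le_trans _ xM).
Qed.

Lemma kernel_prod_bound (M : R) N (x : 'I_N -> R) : 0 < d -> d <= 1 ->
  (forall i, `|x i| <= M) -> (forall i, x i != 0) ->
  (forall i j, i != j -> x i ^+ 2 != x j ^+ 2) ->
  \prod_i `|x i| * \prod_(i < N) \sum_(u < N.+1 | (u < lift ord0 i)%N)
    `|squares x (lift ord0 i) - squares x u| `^ (d - 1) <=
  (M `^ d) ^+ N * \prod_(i < N) (sing_kernel (x i) 0 +
    \sum_(j < N | (j < i)%N) sing_kernel (x i) (x j)).
Proof.
move=> d0 d1 xM x0 xinj.
have -> : (M `^ d) ^+ N = \prod_(i < N) M `^ d by rewrite prodr_const card_ord.
rewrite -!big_split /=.
apply: ler_prod => i _; apply/andP; split.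
  by rewrite mulr_ge0// sumr_ge0// => j _; exact: powR_ge0.
rewrite big_mkcond big_ord_recl /= -big_mkcond /= /squares unlift_none liftK.
rewrite [leLHS]mulrDr [leRHS]mulrDr !mulr_sumr lerD//.
  have := @kernel_bound M (x i) 0 d0 d1 (xM i) (x0 i).
  by rewrite expr0n /= mulr0n sqrf_eq0 x0 => ->.
apply: ler_sum => j ji; rewrite liftK kernel_bound// xinj//.
by apply: contraTneq ji => ->; rewrite ltnn.
Qed.

End Kernel.

(** * Generators divided by the denominator *)

Section Generator.
Variables (R : realType) (N r : nat) (bl : 'I_N -> 'I_(2 * r - 1)).
Implicit Types (x : 'I_N -> R).

Definition generator (w : 'S_N) x : R :=
  \prod_(i < N) \prod_(j < N | (i < j)%N && (bl i == bl j))
     (x (w i) ^+ 2 - x (w j) ^+ 2) *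
  \prod_(i < N | (r <= bl i)%N) x (w i).

Definition denominator x : R :=
  \prod_(i < N) \prod_(j < N | (i < j)%N)
     `|x i ^+ 2 - x j ^+ 2| `^ (2 * r)%:R^-1.

(** The variable of index [w i] belongs to the block of position i, whence the inverse of [w]. The
    product of the |x_i| on the right undoes the Jacobian exponent built into [weight]. *)
Lemma quotient_expE (w : 'S_N) x :
  (forall i, x i != 0) -> (forall i j, i != j -> x i ^+ 2 != x j ^+ 2) ->
  (`|generator w x| / denominator x) ^+ 2 =
  expR (\sum_u \sum_v weight R (bl \o (w^-1)%g) u v *
          ln `|squares x u - squares x v|) * \prod_i `|x i|.
Proof.
move=> x0 xinj; pose a : R := (2 * r)%:R^-1.
pose L i j := ln `|x i ^+ 2 - x j ^+ 2|; pose l i := ln `|x i|.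
have LC i j : L i j = L j i by rewrite /L distrC.
have Lii i : L i i = 0 by rewrite /L subrr normr0 ln0.
have xE i : `|x i| = expR (l i) by rewrite lnK// posrE normr_gt0.
have LE i j : i != j -> `|x i ^+ 2 - x j ^+ 2| = expR (L i j).
  by move=> ij; rewrite lnK// posrE normr_gt0 subr_eq0 xinj.
have genE : `|generator w x| =
    expR (\sum_(i < N) \sum_(j < N | (i < j)%N) (bl i == bl j)%:R * L (w i) (w
      j) +
          \sum_(i < N) (r <= bl i)%N%:R * l (w i)).
  rewrite /generator normrM expRD !expR_sum !normr_prod; congr (_ * _).
    apply: eq_bigr => i _; rewrite expR_sum normr_prod big_mkcondr.
    apply: eq_bigr => j ij; case: ifP => _; last by rewrite mul0r expR0.
    by rewrite mul1r LE// (inj_eq perm_inj) -val_eqE ltn_eqF.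
  rewrite big_mkcond; apply: eq_bigr => i _.
  by case: ifP => _; rewrite ?mul1r ?mul0r ?expR0.
have denE : denominator x =
    expR (\sum_(i < N) \sum_(j < N | (i < j)%N) a * L i j).
  rewrite expR_sum; apply: eq_bigr => i _; rewrite expR_sum.
  apply: eq_bigr => j ij; rewrite LE -?val_eqE ?ltn_eqF//.
  by rewrite -expRM mulrC.
have prodE : \prod_i `|x i| = expR (\sum_i l i).
  by rewrite expR_sum; apply: eq_bigr.
pose b := bl \o (w^-1)%g.
have sameE : 2 * (\sum_(i < N) \sum_(j < N | (i < j)%N)
    (bl i == bl j)%:R * L (w i) (w j)) = \sum_i \sum_j (b i == b j)%:R * L i j.
  rewrite sum_ltn_sym; first last.
  - by move=> i; rewrite Lii mulr0.
  - by move=> i j; rewrite LC eq_sym.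
  rewrite [RHS](reindex_inj (@perm_inj _ w)); apply: eq_bigr => i _.
  rewrite [RHS](reindex_inj (@perm_inj _ w)); apply: eq_bigr => j _.
  by rewrite /b /= !permK.
have allE : 2 * (\sum_(i < N) \sum_(j < N | (i < j)%N) a * L i j) =
    \sum_i \sum_j a * L i j.
  by apply: sum_ltn_sym => [i j|i]; rewrite ?Lii ?mulr0// LC.
have shiftE : \sum_(i < N) (r <= bl i)%N%:R * l (w i) =
    \sum_i (r <= b i)%N%:R * l i.
  rewrite [RHS](reindex_inj (@perm_inj _ w)); apply: eq_bigr => i _.
  by rewrite /b /= permK.
rewrite genE denE prodE -expRN -!expRD -expRM_natl; congr expR.
rewrite mulrBr mulrDr sameE allE shiftE.
have sq i : ln (x i ^+ 2) = 2 * l i.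
  rewrite -(ger0_norm (sqr_ge0 (x i))) normrX lnXn ?normr_gt0// mulr_natl //.
have w0l i : weight R b ord0 (lift ord0 i) * ln `|squares x ord0 - squares x
  (lift ord0 i)|
    = ((r <= b i)%N%:R - 2^-1) * l i.
  rewrite /weight /squares unlift_none liftK sub0r normrN ger0_norm ?sqr_ge0//
    sq.
  by field.
have wl0 i : weight R b (lift ord0 i) ord0 * ln `|squares x (lift ord0 i) -
  squares x ord0|
    = ((r <= b i)%N%:R - 2^-1) * l i.
  rewrite /weight /squares unlift_none liftK subr0 ger0_norm ?sqr_ge0// sq.
  by field.
have wll i j : weight R b (lift ord0 i) (lift ord0 j) *
    ln `|squares x (lift ord0 i) - squares x (lift ord0 j)|
    = (b i == b j)%:R * L i j - a * L i j.
  rewrite /weight /squares !liftK -/(L i j) -mulrBl.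
  by case: eqVneq => // ->; rewrite Lii !mulr0.
have -> : \sum_u \sum_v weight R b u v * ln `|squares x u - squares x v| =
    2 * (\sum_i ((r <= b i)%N%:R - 2^-1) * l i) +
    \sum_i \sum_j ((b i == b j)%:R * L i j - a * L i j).
  rewrite big_ord_recl big_ord_recl weight_diag mul0r add0r.
  rewrite (eq_bigr _ (fun i _ => w0l i)) [X in _ + X](eq_bigr (fun i =>
    ((r <= b i)%N%:R - 2^-1) * l i +
    \sum_j ((b i == b j)%:R * L i j - a * L i j))).
    by rewrite big_split /= addrA mulr2n mulrDl mul1r.
  by move=> i _; rewrite big_ord_recl wl0; congr (_ + _); apply: eq_bigr.
under [X in _ = 2 * X + _ + _]eq_bigr do rewrite mulrBl.
under [X in _ = _ + X + _]eq_bigr do rewrite sumrB.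
by rewrite !sumrB -mulr_sumr; field.
Qed.

Lemma generator_bound (M : R) (w : 'S_N) : (0 < r)%N -> 0 < M ->
  let d := (2 * r * N.+1)%:R^-1 in
  exists2 C : R, 0 <= C & forall x, (forall i, `|x i| <= M) ->
    (forall i, x i != 0) -> (forall i j, i != j -> x i ^+ 2 != x j ^+ 2) ->
    (`|generator w x| / denominator x) ^+ 2 <=
    C * \prod_(i < N) (sing_kernel d (x i) 0 +
          \sum_(j < N | (j < i)%N) sing_kernel d (x i) (x j)).
Proof.
move=> r0 M0 d.
have d0 : 0 < d by rewrite invr_gt0 ltr0n !muln_gt0 r0.
have d1 : d <= 1 by rewrite invf_le1 ?ler1n ?ltr0n !muln_gt0 r0.
(* The squares all lie in [0, M^2], so M^2 bounds their distances. *)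
have [C C0 CP] := @prod_powR_bound R N (weight R (bl \o (w^-1)%g)) d (M ^+ 2)
  (exprn_gt0 _ M0) d1 (@weight_diag R N r _) (@weight_degree_ge0 R N r _ r0).
exists (C * (M `^ d) ^+ N); first by rewrite mulr_ge0 ?exprn_ge0 ?powR_ge0//
  ltW.
move=> x xM x0 xinj; rewrite quotient_expE//.
have sq u : 0 <= squares x u <= M ^+ 2.
  rewrite /squares; case: unliftP => [i _|_]; last by rewrite lexx exprn_ge0//
    ltW.
  by rewrite sqr_ge0 -(ger0_norm (sqr_ge0 (x i))) normrX lerXn2r ?nnegrE// ltW.
have sqinj : injective (squares x).
  move=> u v; rewrite /squares; case: unliftP => [i ->|->]; case: unliftP => [j
    ->|->] //.
  - by move=> /eqP xij; congr lift; apply/eqP; apply: contraTT xij; exact: xinj.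
  - by move/eqP; rewrite sqrf_eq0 (negPf (x0 i)).
  - by move/esym/eqP; rewrite sqrf_eq0 (negPf (x0 j)).
apply: le_trans (ler_wpM2r _ (CP _ sqinj _)) _.
- by rewrite prodr_ge0.
- move=> u v; have := sq u; have := sq v; rewrite ler_norml; lra.
by rewrite -!mulrA ler_wpM2l ?(ltW C0)// mulrC kernel_prod_bound.
Qed.

End Generator.

(** * Integration *)

Local Open Scope classical_set_scope.

Section IteratedKernel.
Variables (R : realType) (kap : R -> R -> R) (K : R).
Hypothesis kap_ge0 : forall x c, 0 <= kap x c.
Hypothesis measurable_kap : measurable_fun
  [set: measurableTypeR R * measurableTypeR R] (fun p => kap p.1 p.2).
Hypothesis kap_int : forall c,
  (\int[lebesgue_measure]_x (kap x c)%:E <= K%:E)%E.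

(** The list [s] holds frozen centres: fixing the first coordinate leaves a chain of the same shape
    with one more centre. *)
Definition chain n (s : seq R) (v : 'rV[R]_n) : R :=
  \prod_(j < n) (\sum_(c <- s) kap (v ord0 j) c +
    \sum_(i < n | (i < j)%N) kap (v ord0 j) (v ord0 i)).

Lemma chain_ge0 n s (v : 'rV[R]_n) : 0 <= chain s v.
Proof. by apply: prodr_ge0 => j _; rewrite addr_ge0// sumr_ge0. Qed.

Lemma chain_cons n s (p : R * 'rV[R]_n) :
  chain s (rV_cons p) = (\sum_(c <- s) kap p.1 c) * chain (p.1 :: s) p.2.
Proof.
rewrite /chain big_ord_recl rV_cons0 [X in _ + X]big_pred0// addr0.
congr (_ * _); apply: eq_bigr => j _; rewrite big_cons rV_consS.
rewrite [X in _ + X]big_mkcond big_ord_recl -big_mkcond /= rV_cons0.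
rewrite addrA (addrC _ (kap _ _)); congr (_ + _).
by apply: eq_bigr => i _; rewrite rV_consS.
Qed.

Lemma measurable_kap_comp d (T : measurableType d) (f g : T -> R) :
  measurable_fun setT f -> measurable_fun setT g ->
  measurable_fun setT (fun x => kap (f x) (g x)).
Proof.
move=> mf mg; have mfg : measurable_fun setT
    (fun x => (f x, g x) : measurableTypeR R * measurableTypeR R).
  exact: measurable_fun_pair.
exact: (measurableT_comp measurable_kap mfg).
Qed.

Lemma measurable_chain n s : measurable_fun [set: 'rV[R]_n] (chain s).
Proof.
apply: measurable_prod => j _; apply: measurable_funD.
  apply: measurable_sum => c; apply: measurable_kap_comp => //.
  exact: measurable_coord.
have E (v : 'rV[R]_n) : \sum_(i < n | (i < j)%N) kap (v ord0 j) (v ord0 i) =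
    \sum_(i < n) if (i < j)%N then kap (v ord0 j) (v ord0 i) else 0.
  exact: big_mkcond.
apply: (eq_measurable_fun (fun v : 'rV[R]_n =>
    \sum_(i < n) if (i < j)%N then kap (v ord0 j) (v ord0 i) else 0)).
  by move=> v _; rewrite -E.
apply: measurable_sum => i; case: (i < j)%N; last exact: measurable_cst.
apply: measurable_kap_comp; exact: measurable_coord.
Qed.

(** Since [K] serves all centres, the inner integral is bounded independently of the first
    coordinate, which then meets only the kernels centred in [s]. *)
Lemma integral_chain_le n s :
  (\int[@lebesgue_rV R n]_v (chain s v)%:E <=
   (((size s + n)%:R * K) ^+ n)%:E)%E.
Proof.
have K0 : 0 <= K.
  rewrite -lee_fin; apply: le_trans (kap_int 0).
  by apply: integral_ge0 => x _; rewrite lee_fin.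
elim: n s => [|n IHn] s.
  rewrite expr0 (_ : @lebesgue_rV R 0 = dirac (0%R : 'rV[R]_0))//.
  rewrite integral_dirac//; last by apply/measurable_EFinP; exact:
    measurable_chain.
  by rewrite /chain big_ord0 diracT mul1e.
have mchain := @measurable_chain n.+1 s.
rewrite (_ : @lebesgue_rV R n.+1 =
  pushforward (lebesgue_measure \x @lebesgue_rV R n)%E (@rV_cons R n))//.
rewrite ge0_integral_pushforward//; first last.
- by move=> v _; rewrite lee_fin chain_ge0.
- exact/measurable_EFinP.
- exact: measurable_rV_cons.
have mcons : measurable_fun [set: measurableTypeR R * 'rV[R]_n]
    (fun p => chain s (rV_cons p)).
  by apply: measurableT_comp mchain _; exact: measurable_rV_cons.
rewrite preimage_setT fubini_tonelli1//=; first last.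
- by move=> p; rewrite /= lee_fin chain_ge0.
- exact/measurable_EFinP.
rewrite /fubini_F /=.
have mk (s' : seq R) : measurable_fun [set: measurableTypeR R]
    (fun x : R => \sum_(c <- s') kap x c).
  by apply: measurable_sum => c; exact: measurable_kap_comp.
(* The bound of the induction hypothesis for x :: s, whose size plus n is [size s + n.+1]. *)
pose B : R := ((size s + n.+1)%:R * K) ^+ n.
have B0 : 0 <= B by rewrite exprn_ge0// mulr_ge0.
apply: le_trans (_ : \int[lebesgue_measure]_x
    ((\sum_(c <- s) kap x c)%:E * B%:E) <= _)%E.
  apply: ge0_le_integral => //.
  - by move=> x _; apply: integral_ge0 => v _; rewrite lee_fin chain_ge0.
  - have := @measurable_fun_fubini_tonelli_F _ _ _ _ _ (@lebesgue_rV R n)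
      (fun p : measurableTypeR R * 'rV[R]_n => (chain s (rV_cons p))%:E).
    by apply=> [|p]; [apply/measurable_EFinP|rewrite lee_fin chain_ge0].
  - by under eq_fun do rewrite -EFinM; apply/measurable_EFinP/measurable_funM.
  move=> x _; rewrite (eq_integral (fun v => (\sum_(c <- s) kap x c)%:E *
      (chain (x :: s) v)%:E)%E); last first.
    by move=> v _; rewrite chain_cons EFinM.
  rewrite (@ge0_integralZl _ _ _ _ _ measurableT (fun v => (chain (x :: s)
    v)%:E)).
  - by rewrite lee_wpmul2l ?lee_fin ?sumr_ge0// /B -addSnnS; exact: IHn.
  - by apply/measurable_EFinP; exact: measurable_chain.
  - by move=> v _; rewrite lee_fin chain_ge0.
  - by rewrite lee_fin sumr_ge0.
rewrite (@ge0_integralZr _ _ _ _ _ measurableT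
  (fun x : measurableTypeR R => (\sum_(c <- s) kap x c)%:E)); first last.
- by rewrite lee_fin.
- by move=> x _; rewrite lee_fin sumr_ge0.
- exact/measurable_EFinP.
apply: le_trans (_ : (((size s)%:R * K)%:E * B%:E <= _)%E).
  rewrite lee_wpmul2r ?lee_fin//.
  under eq_integral do rewrite -sumEFin.
  rewrite ge0_integral_sum//; first last.
  - by move=> c x _; rewrite lee_fin.
  - by move=> c; apply/measurable_EFinP; exact: measurable_kap_comp.
  apply: le_trans (_ : (\sum_(c <- s) K%:E <= _)%E); first exact: lee_sum.
  by rewrite sumEFin big_const_seq count_predT iter_addr_0 mulr_natl.
rewrite -EFinM lee_fin exprS -/B ler_wpM2r// ler_wpM2r// ler_nat.
exact: leq_addr.
Qed.

End IteratedKernel.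

(** * Integrals of |x - c|^(d - 1), uniformly in c *)

Section PowerIntegral.
Variables (R : realType) (d : R).
Hypotheses (d0 : 0 < d) (d1 : d <= 1).

(** Halving the distance to c multiplies the kernel by [q] and the length of the ball by 1/2; d > 0
    makes q / 2 the ratio of a convergent geometric series. *)
Let q : R := 2 `^ (1 - d).
Let g (c : R) n (x : R) : R := 2 * q ^+ n * \1_(ball c (2^-1 ^+ n)) x.

Let q_ge1 : 1 <= q.
Proof. by rewrite /q -[leLHS](powRr0 2) ler_powR ?ler1n ?subr_ge0. Qed.

Let q_le2 : q <= 2.
Proof.
by rewrite /q -[leRHS]powRr1// ler_powR ?ler1n// gerBl ltW.
Qed.

Let q_lt2 : q / 2 < 1.
Proof.
rewrite ltr_pdivrMr// mul1r lt_neqAle q_le2 andbT.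
apply/eqP => q2; have := @powRD R 2 d (1 - d).
rewrite subrKC powRr1// oner_eq0 -/q q2 => /(_ isT) E.
have : 2 `^ d = 1 by apply: (mulIf (lt0r_neq0 (ltr0n R 2))); rewrite mul1r -E.
by move/eqP; rewrite powR_eq1 (gt_eqF d0) orbF pnatr_eq1 ltrn0.
Qed.

Let dyadic (t : R) : 0 < t < 1 -> exists n, 2^-1 ^+ n.+1 <= t < 2^-1 ^+ n.
Proof.
move=> /andP[t0 t1]; have ex : exists m, 2^-1 ^+ m <= t.
  exists (Num.bound t^-1); rewrite exprVn invf_ple ?posrE ?exprn_gt0//.
  have /ltW := archi_boundP (ltW (eqbRL (invr_gt0 t) t0)).
  by move=> /le_trans; apply; rewrite -natrX ler_nat ltnW// ltn_expl.
case: (ex_minnP ex) => -[|n] tn nmin; first by move: tn; rewrite expr0 leNgt t1.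
exists n; rewrite tn /= ltNge; apply/negP => /nmin; by rewrite ltnn.
Qed.

Let powR_half n : (2^-1 ^+ n) `^ (d - 1) = q ^+ n.
Proof.
rewrite -(@powR_mulrn _ 2^-1) ?invr_ge0// powRAC powR_mulrn ?powR_ge0//; congr
  (_ ^+ n).
by rewrite -powR_inv1// -powRrM mulN1r opprB.
Qed.

(** At distance between 2^-(n + 1) and 2^-n the power is at most q^(n + 1) <= 2 q^n, which the ball
    of index n supplies; at distance at least 1 the constant suffices. *)
Lemma powR_le_dyadic (c x : R) :
  ((`|x - c| `^ (d - 1))%:E <= 1%:E + \sum_(n <oo) (g c n x)%:E)%E.
Proof.
have g0 n : 0 <= g c n x.
  by rewrite /g !mulr_ge0// exprn_ge0// powR_ge0.
set t := `|x - c|.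
have [/dyadic[n /andP[nt tn]]|t01] := boolP (0 < t < 1).
  apply: (@le_trans _ _ (g c n x)%:E); last first.
    rewrite -[leLHS]add0e leeD// ?lee_fin//.
    apply: le_trans (nneseries_lim_ge n.+1 _); last by move=> k _ _; rewrite
      lee_fin.
    by rewrite big_nat_recr//= leeDr// sume_ge0// => k _; rewrite lee_fin.
  have xc : x \in (ball c (2^-1 ^+ n) : set R) by rewrite inE /ball /= distrC.
  rewrite lee_fin /g indicE xc mulr1.
  apply: (@le_trans _ _ (q ^+ n.+1)); last first.
    by rewrite exprS ler_wpM2r// exprn_ge0// (le_trans _ q_ge1).
  have h0 : 0 < (2^-1 : R) ^+ n.+1 by rewrite exprn_gt0// invr_gt0.
  rewrite -powR_half -opprB !powRN lef_pV2 ?posrE ?powR_gt0//.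
    by apply: ge0_ler_powR; rewrite ?nnegrE ?subr_ge0 ?(ltW h0) ?normr_ge0.
  exact: lt_le_trans nt.
rewrite -[leLHS]adde0 leeD//; last first.
  by apply: nneseries_ge0 => n _ _; rewrite lee_fin.
(* At the centre the power takes its default value: 0, or 1 when d = 1. *)
rewrite lee_fin; have [t0|t0] := eqVneq t 0.
  rewrite t0; have [->|dn1] := eqVneq (d - 1) 0; first by rewrite powRr0.
  by rewrite powR0.
have t1 : 1 <= t.
  by rewrite leNgt; apply: contra t01 => ->; rewrite lt_def t0 normr_ge0.
by rewrite -[leRHS](powRr0 t) ler_powR// subr_le0.
Qed.

Lemma integral_powR_le (M : R) : 0 < M -> exists K : R, forall c,
  (\int[lebesgue_measure]_(x in `[(- M)%R, M]) (`|x - c| `^ (d - 1))%:E <=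
    K%:E)%E.
Proof.
(* 2M is the length of the interval; the ball of index n contributes at most 2 q^n times 2 * 2^-n,
   that is 4 (q / 2)^n, for every c. *)
move=> M0; exists (2 * M + 4 * (1 - q / 2)^-1) => c.
have mI : measurable `[(- M)%R, M] by exact: measurable_itv.
have g0 n x : 0 <= g c n x by rewrite /g !mulr_ge0// exprn_ge0// powR_ge0.
have mg n : measurable_fun (setT : set (measurableTypeR R)) (g c n).
  apply: measurable_funM => //; apply: measurable_indic.
  exact: measurable_ball.
have mS : measurable_fun (`[(- M)%R, M] : set (measurableTypeR R)) (fun x =>
  \sum_(n <oo) (g c n x)%:E)%E.
  apply: ge0_emeasurable_sum => n.
    by move=> x _ _; rewrite lee_fin.
  by move=> _; apply/measurable_EFinP; exact: measurable_funTS.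
apply: (@le_trans _ _ (\int[lebesgue_measure]_(x in `[(- M)%R, M])
    (1%:E + \sum_(n <oo) (g c n x)%:E))%E).
  apply: ge0_le_integral => //.
  - apply/measurable_EFinP; apply: measurableT_comp (measurable_powR _) _.
    by apply: measurableT_comp => //; exact: measurable_funB.
  - exact: emeasurable_funD.
  - by move=> x _; exact: powR_le_dyadic.
rewrite ge0_integralD//; first last.
- by move=> x _; apply: nneseries_ge0 => n _ _; rewrite lee_fin.
rewrite integral_cst// mul1e /= lebesgue_measure_itv/= lte_fin.
rewrite gtrN// -EFinD opprK EFinD.
rewrite integral_nneseries//; first last.
- by move=> n x _; rewrite lee_fin.
- by move=> n; apply/measurable_EFinP; exact: measurable_funTS.
rewrite -mulr2n mulr_natl EFinD leeD//.
apply: lime_le => //.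
  by apply: is_cvg_nneseries => n _ _; apply: integral_ge0 => x _; rewrite
    lee_fin.
apply: nearW => n.
apply: (@le_trans _ _ ((series (geometric (4 : R) (q / 2)) n)%:E)).
  rewrite /series /= -sumEFin; apply: lee_sum => k _.
  have mB : measurable (ball c (2^-1 ^+ k) : set (measurableTypeR R)).
    exact: measurable_ball.
  rewrite (eq_integral (fun x => (2 * q ^+ k)%:E *
    (\1_(ball c (2^-1 ^+ k) : set (measurableTypeR R)) x)%:E)%E)//.
  rewrite ge0_integralZl_EFin//; first last.
  - by rewrite mulr_ge0// exprn_ge0// powR_ge0.
  - by apply/measurable_EFinP; exact: measurable_indic.
  rewrite integral_indic//.
  apply: (@le_trans _ _ ((2 * q ^+ k)%:E * lebesgue_measure (ball c (2^-1 ^+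
    k)))%E).
    rewrite lee_wpmul2l ?lee_fin ?mulr_ge0// ?exprn_ge0// ?powR_ge0//.
    apply: le_measure; rewrite ?inE; [|exact: measurable_ball|exact: subIsetl].
    by apply: measurableI => //; exact: measurable_ball.
  rewrite lebesgue_measure_ball ?exprn_ge0 ?invr_ge0// -EFinM lee_fin.
  by rewrite /geometric /= exprMn -mulr_natl; nra.
rewrite lee_fin geometric_le_lim ?divr_gt0 ?(lt_le_trans _ q_ge1)//.
by rewrite ger0_norm ?divr_ge0 ?(le_trans _ q_ge1).
Qed.

End PowerIntegral.

Section CutKernel.
Variables (R : realType) (d M : R).
Hypotheses (d0 : 0 < d) (d1 : d <= 1) (M0 : 0 < M).

(** Only [x] is confined to the interval: this makes the integral over the line finite while the
    centre stays arbitrary, as the iteration requires. *)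
Definition cut_kernel (x c : R) : R := \1_(`[- M, M] : set R) x * sing_kernel d
  x c.

Lemma cut_kernel_ge0 x c : 0 <= cut_kernel x c.
Proof. by rewrite mulr_ge0 ?kernel_ge0. Qed.

Lemma cut_kernelE x c : `|x| <= M -> cut_kernel x c = sing_kernel d x c.
Proof. by move=> xM; rewrite /cut_kernel indicE mem_set ?mul1r//= in_itv /=
  -ler_norml. Qed.

Lemma measurable_cut_kernel : measurable_fun
  [set: measurableTypeR R * measurableTypeR R] (fun p => cut_kernel p.1 p.2).
Proof.
have m1 : measurable_fun [set: measurableTypeR R * measurableTypeR R]
  (fun p => p.1 : R) := measurable_fst.
have m2 : measurable_fun [set: measurableTypeR R * measurableTypeR R]
  (fun p => p.2 : R) := measurable_snd.
apply: measurable_funM.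
  by apply: measurableT_comp m1; exact: measurable_indic.
apply: measurable_funD; apply: measurableT_comp (measurable_powR _) _;
  apply: measurableT_comp => //.
- exact: measurable_funB.
- exact: measurable_funD.
Qed.

Lemma integral_cut_kernel_le : exists K : R, forall c,
  (\int[lebesgue_measure]_x (cut_kernel x c)%:E <= K%:E)%E.
Proof.
have [K KP] := integral_powR_le d0 d1 M0; exists (K + K) => c.
have mp (a : R) : measurable_fun (`[(- M)%R, M] : set (measurableTypeR R))
    (fun x => (`|x - a| `^ (d - 1))%:E).
  apply/measurable_EFinP; apply: measurableT_comp (measurable_powR _) _.
  by apply: measurableT_comp => //; exact: measurable_funB.
rewrite (_ : (\int[_]_x _)%E = (\int[lebesgue_measure]_(x in `[(- M)%R, M])
    ((`|x - c| `^ (d - 1))%:E + (`|x - (- c)| `^ (d - 1))%:E))%E).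
  by rewrite ge0_integralD// EFinD leeD.
rewrite [RHS]integral_mkcond; apply: eq_integral => x _.
rewrite patchE /cut_kernel indicE opprK; case: (_ \in _); rewrite ?mul0r//.
by rewrite mul1r.
Qed.

End CutKernel.

(** * Size and measurability of polynomial values *)

Section Evaluation.
Variables (R : realType) (N : nat).
Local Open Scope complex_scope.
Notation normc := ComplexField.Normc.normc.

Lemma normc_sum (I : Type) (s : seq I) (F : I -> R[i]) :
  normc (\sum_(i <- s) F i) <= \sum_(i <- s) normc (F i).
Proof.
elim/big_ind2 : _ => // [|x a y b xa yb]; first by rewrite
  ComplexField.Normc.normc0.
by apply: le_trans (lerD xa yb); exact: le_normcD.
Qed.

Lemma normc_real (x : R) : normc x%:C = `|x|.
Proof. by rewrite /= expr0n addr0 sqrtr_sqr. Qed.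

Lemma evalmp_bounded (f : mpoly.mpoly N R[i]) (M : R) : 0 <= M ->
  exists2 K : R, 0 <= K & forall x : 'I_N -> R, (forall i, `|x i| <= M) ->
    normc (evalmp f (fun i => (x i)%:C)) <= K.
Proof.
move=> M0; have [s sE] := evalmpE f.
have nc0 z : 0 <= normc z :> R by case: z => a b; exact: sqrtr_ge0.
exists (\sum_(t <- s) normc t.1 * \prod_i M ^+ t.2 i).
  by rewrite sumr_ge0// => t _; rewrite mulr_ge0// prodr_ge0// => i _; rewrite
    exprn_ge0.
move=> x xM; rewrite sE; apply: le_trans (normc_sum _ _) _.
apply: ler_sum => t _; rewrite ComplexField.Normc.normcM ler_wpM2l//.
under eq_bigr do rewrite -rmorphXn.
rewrite -rmorph_prod normc_real normr_prod; apply: ler_prod => i _.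
by rewrite normr_ge0 normrX lerXn2r ?nnegrE.
Qed.

Lemma measurable_normc_evalmp (f : mpoly.mpoly N R[i]) :
  measurable_fun [set: 'rV[R]_N]
    (fun v => normc (evalmp f (fun i => (v ord0 i)%:C)) ^+ 2).
Proof.
have [s sE] := evalmpE f.
(* At real points, taking real or imaginary parts of the coefficients gives the real or imaginary
   part of the value. *)
pose P (h : R[i] -> R) (v : 'rV[R]_N) : R :=
  \sum_(t <- s) h t.1 * \prod_i v ord0 i ^+ t.2 i.
have mP h : measurable_fun setT (P h).
  apply: measurable_sum => t; apply: measurable_funM => //.
  apply: measurable_prod => i _; apply: measurable_funX; exact:
    measurable_coord.
rewrite (_ : (fun v => _) = fun v => P (@complex.Re R) v ^+ 2 + P (@complex.Im
  R) v ^+ 2).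
  by apply: measurable_funD; exact: measurable_funX.
apply/funext => v; set z := evalmp _ _.
have -> : normc z ^+ 2 = complex.Re z ^+ 2 + complex.Im z ^+ 2.
  by case: z => a b; rewrite /= sqr_sqrtr// addr_ge0// sqr_ge0.
suff -> : z = (P (@complex.Re R) v)%:C + 'i%C * (P (@complex.Im R) v)%:C.
  by rewrite /= !mul0r !mul1r ?oppr0 ?subr0 ?addr0 ?add0r ?mulr0 ?subr0 ?addr0.
rewrite /z sE /P !rmorph_sum mulr_sumr -big_split; apply: eq_bigr => t _ /=.
rewrite [in LHS](complexE t.1) !rmorphM rmorph_prod mulrA -mulrDl; congr (_ *
  _).
by apply: eq_bigr => i _; rewrite rmorphXn.
Qed.

End Evaluation.

(** * Local square integrability *)

Local Open Scope complex_scope.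

Section Assembly.
Variables (R : realType) (N r : nat).
Hypothesis r0 : (0 < r)%N.
Notation normc := ComplexField.Normc.normc.
Let k := (2 * r - 1)%N.
Let d : R := (2 * r * N.+1)%:R^-1.

Let k0 : (0 < k)%N. Proof. by rewrite /k; lia. Qed.

Let block_subproof (i : 'I_N) : (reshape_index (nuNk N k) i < k)%N.
Proof.
rewrite -[X in (_ < X)%N](size_nuNk N k0); apply: reshape_indexP.
by rewrite sumn_nuNk.
Qed.

Let block (i : 'I_N) : 'I_k := Ordinal (block_subproof i).

Lemma evalmp_Kodd (f : mpoly.mpoly N R[i]) : Kodd k f ->
  exists c : 'S_N -> mpoly.mpoly N R[i], forall x : 'I_N -> R,
    evalmp f (fun i => (x i)%:C) =
    \sum_w evalmp (c w) (fun i => (x i)%:C) * (generator block w x)%:C.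
Proof.
move=> /(evalmp_Kks k0)[c cE]; exists c => x; rewrite cE.
apply: eq_bigr => w _; congr (_ * _).
rewrite /generator rmorphM !rmorph_prod /=; congr (_ * _).
  apply: eq_bigr => i _; rewrite rmorph_prod; apply: eq_bigr => j _.
  by rewrite rmorphB !rmorphXn.
(* Half of k is r - 1, so T starts at block number k - (r - 1) = r. *)
apply: eq_bigl => i; rewrite inE (block_subproof i) andbT; congr (_ <= _)%N.
by rewrite /k; lia.
Qed.

Lemma denominator_ge0 (x : 'I_N -> R) : 0 <= denominator r x.
Proof.
by apply: prodr_ge0 => i _; apply: prodr_ge0 => j _; exact: powR_ge0.
Qed.

Lemma normc_quot (f : mpoly.mpoly N R[i]) (v : 'rV[R]_N) :
  normc (quot_vdm_sq (1 / (2 * r)%:R) f v) =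
  normc (evalmp f (fun i => (v ord0 i)%:C)) / denominator r (v ord0).
Proof.
rewrite /quot_vdm_sq ComplexField.Normc.normcM ComplexField.Normc.normcV.
by rewrite div1r normc_real ger0_norm// denominator_ge0.
Qed.

Lemma denominator_eq0 (x : 'I_N -> R) i j : i != j -> x i ^+ 2 = x j ^+ 2 ->
  denominator r x = 0.
Proof.
wlog ij : i j / (i < j)%N => [W|_].
  rewrite -val_eqE; case: ltngtP => // ij _ xij; first by apply: (W i j) => //;
    rewrite -val_eqE ltn_eqF.
  by apply: (W j i) => //; rewrite -val_eqE ltn_eqF.
move=> xx; rewrite /denominator (bigD1 i)//= (bigD1 j)//=.
by rewrite xx subrr normr0 powR0 ?mul0r// invr_eq0 pnatr_eq0 muln_eq0 negb_or
  -!lt0n r0.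
Qed.

(* The coordinates must be nonzero because 0 `^ (d - 1) = 0. *)
Lemma quot_bound (f : mpoly.mpoly N R[i]) (M : R) : Kodd k f -> 0 < M ->
  exists2 C : R, 0 <= C & forall v : 'rV[R]_N, (forall i, `|v ord0 i| <= M) ->
    (forall i, v ord0 i != 0) ->
    normc (quot_vdm_sq (1 / (2 * r)%:R) f v) ^+ 2 <=
    C * chain (cut_kernel d M) [:: 0] v.
Proof.
move=> /evalmp_Kodd[c cE] M0.
have d0 : 0 < d by rewrite invr_gt0 ltr0n !muln_gt0 r0.
have [C CP] := choice (fun w => iffLR (exists2P _ _) (generator_bound block w r0
  M0)).
have [K KP] := choice (fun w => iffLR (exists2P _ _) (evalmp_bounded (c w) (ltW
  M0))).
exists ((\sum_w K w * Num.sqrt (C w)) ^+ 2) => [|v vM v0]; first exact: sqr_ge0.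
(* Where two squares coincide the denominator is 0, hence so is the quotient by convention. *)
have [inj|] := pselect (forall i j, i != j -> v ord0 i ^+ 2 != v ord0 j ^+ 2);
    last first.
  move=> /existsNP[i1 /existsNP[j1 /not_implyP[ij /negP]]].
  rewrite negbK => /eqP vij.
  rewrite normc_quot (denominator_eq0 ij vij) invr0 mulr0 expr0n /=.
  by rewrite mulr_ge0 ?sqr_ge0// chain_ge0// => x e; exact: cut_kernel_ge0.
set X := chain _ _ _.
have X0 : 0 <= X by rewrite chain_ge0// => x e; exact: cut_kernel_ge0.
have XE : X = \prod_(i < N) (sing_kernel d (v ord0 i) 0 +
    \sum_(j < N | (j < i)%N) sing_kernel d (v ord0 i) (v ord0 j)).
  apply: eq_bigr => i _; rewrite big_seq1 cut_kernelE//; congr (_ + _).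
  by apply: eq_bigr => j _; rewrite cut_kernelE.
have nc0 (z : R[i]) : 0 <= normc z by case: z => a b; exact: sqrtr_ge0.
rewrite -[X](sqr_sqrtr X0) -exprMn lerXn2r ?nnegrE//.
  rewrite mulr_ge0 ?sqrtr_ge0// sumr_ge0// => w _.
  by rewrite mulr_ge0 ?sqrtr_ge0//; case: (KP w).
rewrite normc_quot cE.
apply: le_trans (ler_wpM2r _ (normc_sum _ _)) _.
  by rewrite invr_ge0 denominator_ge0.
rewrite !mulr_suml; apply: ler_sum => w _.
rewrite ComplexField.Normc.normcM normc_real -!mulrA.
have [C0 /(_ (v ord0) vM v0 inj) genX] := CP w.
have [K0 /(_ _ vM) coefK] := KP w.
apply: ler_pM => //; first by rewrite divr_ge0 ?denominator_ge0.
rewrite -sqrtrM// -[leLHS]ger0_norm ?divr_ge0 ?denominator_ge0// -sqrtr_sqr.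
by rewrite ler_wsqrtr// XE.
Qed.

End Assembly.

(** A coordinate hyperplane is a box with one side equal to {0}; its measure is 0 because 0 times
    infinity is 0. *)
Lemma lebesgue_rV_ae_neq0 (R : realType) n :
  {ae @lebesgue_rV R n, forall v : 'rV[R]_n, forall i, v ord0 i != 0}.
Proof.
have H (i : 'I_n) : {ae @lebesgue_rV R n, forall v : 'rV[R]_n, v ord0 i != 0}.
  pose A (j : 'I_n) : set R := if j == i then [set 0] else setT.
  have mA j : measurable (A j) by rewrite /A; case: ifP.
  exists [set v : 'rV[R]_n | forall j, A j (v ord0 j)]; split.
  - rewrite (_ : mkset _ = (fun v : 'rV[R]_n => v ord0 i) @^-1` [set 0]).
      by rewrite -[X in measurable X]setTI; exact: measurable_coord.
    apply/seteqP; split=> v /= => [/(_ i)|vi0 j]; first by rewrite /A eqxx.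
    by rewrite /A; case: eqVneq => // ->.
  - rewrite lebesgue_rV_box// (bigD1 i)//= {1}/A eqxx.
    by rewrite lebesgue_measure_set1 mul0e.
  - move=> v /negP; rewrite negbK => /eqP vi0 j; rewrite /A /=.
    by case: eqVneq => // ->.
exact: filter_forall.
Qed.

Lemma nbhs_box (R : realType) n (x : 'rV[R]_n) :
  nbhs x [set v : 'rV[R]_n | forall i, `|v ord0 i| <= 1 + \sum_j `|x ord0 j|].
Proof.
apply/nbhs_ballP; exists 1 => //= v [_ xv] i.
have := xv ord0 i; rewrite /ball /= => xvi.
have : `|x ord0 i| <= \sum_j `|x ord0 j| by rewrite (bigD1 i)//= lerDl sumr_ge0.
have := ler_distD (x ord0 i) (v ord0 i) 0; rewrite !subr0 distrC; lra.
Qed.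

Lemma measurable_normc_quot (R : realType) N r (f : mpoly.mpoly N R[i]) :
  measurable_fun [set: 'rV[R]_N] (fun v =>
    ComplexField.Normc.normc (quot_vdm_sq (1 / (2 * r)%:R) f v) ^+ 2).
Proof.
(* The power with exponent -1 agrees with the inverse even at 0, where both are 0. *)
rewrite (_ : (fun v => _) = fun v : 'rV[R]_N =>
  ComplexField.Normc.normc (evalmp f (fun i => (v ord0 i)%:C)) ^+ 2 *
  (denominator r (v ord0) ^+ 2) `^ (-1)); last first.
  apply/funext => v; rewrite normc_quot expr_div_n powR_inv1//; exact: sqr_ge0.
apply: measurable_funM; first exact: measurable_normc_evalmp.
apply: measurableT_comp (measurable_powR _) _; apply: measurable_funX.
apply: measurable_prod => i _.
have E (v : 'rV[R]_N) : \prod_(j < N | (i < j)%N)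
    `|v ord0 i ^+ 2 - v ord0 j ^+ 2| `^ (2 * r)%:R^-1 =
  \prod_(j < N) if (i < j)%N
    then `|v ord0 i ^+ 2 - v ord0 j ^+ 2| `^ (2 * r)%:R^-1 else 1.
  exact: big_mkcond.
apply: (eq_measurable_fun (fun v : 'rV[R]_N => \prod_(j < N) if (i < j)%N
    then `|v ord0 i ^+ 2 - v ord0 j ^+ 2| `^ (2 * r)%:R^-1 else 1)).
  by move=> v _; rewrite -E.
apply: measurable_prod => j _; case: (i < j)%N; last exact: measurable_cst.
apply: measurableT_comp (measurable_powR _) _; apply: measurableT_comp => //.
by apply: measurable_funB; apply: measurable_funX; exact: measurable_coord.
Qed.

Theorem theorem5p4 (R : realType) (N r : nat) (r_gt0 : (0 < r)%N)
    (r_le : (2 * r <= N)%N) (f : mpoly.mpoly N R[i])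
    (Kf : Kodd (2 * r - 1)%N f) :
  locally_L2 (quot_vdm_sq (1 / (2 * r)%:R) f).
Proof.
move=> x; pose M := 1 + \sum_j `|x ord0 j|.
have M0 : 0 < M by rewrite ltr_pwDl// sumr_ge0.
pose U := [set v : 'rV[R]_N | forall i, `|v ord0 i| <= M].
have mU : measurable U.
  rewrite (_ : U = \bigcap_(i in [set: 'I_N])
      ((fun v : 'rV[R]_N => v ord0 i) @^-1` `[- M, M])).
    apply: fin_bigcap_measurable => // i _.
    by rewrite -[X in measurable X]setTI; apply: measurable_coord.
  by apply/seteqP; split=> v /= => [h i _|h i];
    have := h i; rewrite /= in_itv /= -ler_norml; [|apply].
exists U; split=> //; first exact: nbhs_box.
have mq := @measurable_normc_quot R N r f.
have [C C0 CP] := quot_bound r_gt0 Kf M0.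
have d0 : 0 < (2 * r * N.+1)%:R^-1 :> R.
  by rewrite invr_gt0 ltr0n !muln_gt0 r_gt0.
have d1 : (2 * r * N.+1)%:R^-1 <= 1 :> R.
  by rewrite invf_le1 ?ler1n ?ltr0n !muln_gt0 r_gt0.
have [K KP] := integral_cut_kernel_le d0 d1 M0.
set kap := cut_kernel _ M in CP KP.
have kap0 : forall y c, 0 <= kap y c := cut_kernel_ge0 _ _.
have mkap := measurable_cut_kernel (2 * r * N.+1)%:R^-1 M.
have mchain := measurable_chain mkap (n := N) [:: 0].
apply/integrableP; split; first by apply/measurable_EFinP; exact:
  measurable_funTS.
(* The cut kernels allow the domain to grow from the box to the whole space; the list [[:: 0]]
   supplies the extra point as first centre. *)
apply: (@le_lt_trans _ _ (\int[@lebesgue_rV R N]_v (C * chain kap [:: 0]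
  v)%:E)%E).
  apply: (@le_trans _ _
    (\int[@lebesgue_rV R N]_(v in U) (C * chain kap [:: 0] v)%:E)%E).
    apply: ae_ge0_le_integral => //.
    - by apply: measurableT_comp => //; apply/measurable_EFinP; exact:
      measurable_funTS.
    - by move=> v _; rewrite lee_fin mulr_ge0 ?chain_ge0.
    - apply/measurable_EFinP; apply: measurable_funM => //; exact:
      measurable_funTS.
    (* The pointwise bound is available only off the coordinate hyperplanes, which form a null
       set. *)
    - have := @lebesgue_rV_ae_neq0 R N; apply: filterS => v v0 vU.
      by rewrite abse_EFin ger0_norm ?sqr_ge0// lee_fin CP.
  apply: ge0_subset_integral => //.
  - by apply/measurable_EFinP; exact: measurable_funM.
  - by move=> v _; rewrite lee_fin mulr_ge0 ?chain_ge0.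
under eq_integral do rewrite EFinM.
rewrite ge0_integralZl_EFin//.
- apply: le_lt_trans (_ : C%:E * (((size [:: 0 : R] + N)%:R * K) ^+ N)%:E <
  _)%E.
    by rewrite lee_wpmul2l ?lee_fin//; exact: integral_chain_le.
  by rewrite -EFinM ltry.
- by move=> v _; rewrite lee_fin chain_ge0.
- exact/measurable_EFinP.
Qed.
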